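(* Let $\Bbbk$ be an algebraically closed field of characteristic zero, $\Gamma$ a finite group and $\widehat{\Gamma}=\mathrm{Hom}(\Gamma,\Bbbk^* )$. Let $H=\bigoplus_{n\ge 0}H_n$ be a finite-dimensional coradically graded pointed Hopf algebra with group of group-like elements $G(H)=\Gamma$, generated as an algebra by $\Gamma$ and $H_1$. Let $x_1,\dots,x_\theta$ be a basis of the space $V$ of coinvariants of $H_1$ such that $\Delta(x_i)=x_i\otimes g_i+1\otimes x_i$ for some $g_i\in\Gamma$. Then there exists a bijection between (a) braided central Hopf subalgebras $(K,r)$ of $H$, and (b) pairs $(G,\Phi)$, where $G$ is a central subgroup of $\Gamma$ and $\Phi:G\to\widehat{\Gamma}$ is a group morphism such that $$\langle g',\Phi(g)\rangle=1,\qquad g x_i g^{-1}=\langle g_i,\Phi(g)\rangle x_i$$ for all $g,g'\in G$ and $1\le i\le\theta$. The correspondence is given by taking $K=\Bbbk G$ and taking $r$ to be the linear extension to $H_0\otimes K$ of the evaluation map $\langle\cdot,\Phi(\cdot)\rangle:\Gamma\times G\to\Bbbk$, extended as zero on $H_n\otimes K$ for $n\ge 1$.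
   Context: Here $\langle\gamma,\chi\rangle=\chi(\gamma)$ for $\gamma\in\Gamma$, $\chi\in\widehat{\Gamma}$. Coradically graded means that $H=\bigoplus_{n\ge0}H_n$ is a graded Hopf algebra whose coradical filtration has $n$-th term $\bigoplus_{m\le n}H_m$; in particular $H_0=\Bbbk\Gamma$. The coinvariants are taken with respect to the graded projection $p:H\to H_0$, i.e. $V=\{x\in H_1:(p\otimes\mathrm{id})\Delta(x)=1\otimes x\}$; then $H\simeq\mathcal{B}(V)\#\Bbbk\Gamma$, with $\mathcal{B}(V)$ the Nichols algebra of $V$. A braided central Hopf subalgebra of $H$ is a pair $(K,r)$ with $K\subset H$ a Hopf subalgebra and $r:H\otimes K\to\Bbbk$ a bilinear form such that for all $h,h'\in H$, $k,k'\in K$ (Sweedler notation $\Delta(h)=h_1\otimes h_2$): $r(hh',k)=r(h',k_1)r(h,k_2)$; $r(h,kk')=r(h_1,k)r(h_2,k')$; $r(h,1)=\varepsilon(h)$, $r(1,k)=\varepsilon(k)$; $r(h_1,k_1)k_2h_2=h_1k_1r(h_2,k_2)$; $r(k,k')=\varepsilon(kk')$. *)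

(* Defs.v *)
From HB Require Import structures.
From mathcomp Require Import all_boot all_order all_fingroup all_algebra.
From mathcomp Require Import all_solvable all_field.

Set Implicit Arguments.
Unset Strict Implicit.
Unset Printing Implicit Defensive.

Import GRing.Theory.
Local Open Scope ring_scope.

(* U (x) V is modelled by coordinate matrices with respect to the bases        *)
(* [vbasis fullv] of U and V; [tensE] and [tlift_tens] below give the          *)
(* decomposition into pure tensors and the universal property.                 *)
Definition tensor (k : fieldType) (U V : vectType k) :=
  'M[k]_(\dim {: U}, \dim {: V}).

HB.instance Definition _ (k : fieldType) (U V : vectType k) :=
  Vector.on (tensor U V).

Section Tensor.

Variable k : fieldType.
Implicit Types U V W : vectType k.

Definition tens U V (u : U) (v : V) : tensor U V :=
  \matrix_(i, j) (coord (vbasis fullv) i u * coord (vbasis fullv) j v).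

(* For t = \sum u (x) v, this is \sum f u v whenever f is bilinear: it is how  *)
(* Sweedler sums are written below.                                            *)
Definition tlift U V W (f : U -> V -> W) (t : tensor U V) : W :=
  \sum_i \sum_j t i j *: f (vbasis fullv)`_i (vbasis fullv)`_j.

Fact tlift_is_linear U V W (f : U -> V -> W) : linear (tlift f).
Proof.
move=> a s t; rewrite /tlift scaler_sumr -big_split; apply: eq_bigr => i _ /=.
rewrite scaler_sumr -big_split; apply: eq_bigr => j _ /=.
by rewrite !mxE scalerDl scalerA.
Qed.

HB.instance Definition _ U V W (f : U -> V -> W) :=
  GRing.isSemilinear.Build k (tensor U V) W _ (tlift f)
    (GRing.semilinear_linear (tlift_is_linear f)).

Definition bilin U V W (f : U -> V -> W) : Prop :=
  (forall v, linear (f^~ v)) /\ (forall u, linear (f u)).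

Lemma tlift_tens U V W (f : U -> V -> W) (u : U) (v : V) :
  bilin f -> tlift f (tens u v) = f u v.
Proof.
case=> fl fr; rewrite /tlift.
pose fL y : {linear U -> W} :=
  HB.pack (f^~ y) (GRing.isLinear.Build k U W _ (f^~ y) (fl y)).
pose fR x : {linear V -> W} :=
  HB.pack (f x) (GRing.isLinear.Build k V W _ (f x) (fr x)).
rewrite [in RHS](coord_vbasis (memvf u)) -[RHS]/(fL v _) linear_sum.
apply: eq_bigr => i _; rewrite linearZ /=.
rewrite [in RHS](coord_vbasis (memvf v)) -[X in _ *: X]/(fR _ _) linear_sum.
rewrite scaler_sumr; apply: eq_bigr => j _.
by rewrite linearZ /= mxE scalerA.
Qed.

Lemma tens_bilin U V : bilin (@tens U V).
Proof.
by split=> [v|u] a x y; apply/matrixP=> i j;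
  rewrite !mxE linearP ?mulrDl ?mulrDr ?mulrA // [_ * a]mulrC.
Qed.

Lemma tensE U V (t : tensor U V) :
  t = \sum_i \sum_j t i j *: tens (vbasis fullv)`_i (vbasis fullv)`_j.
Proof.
apply/matrixP=> i j; rewrite summxE (bigD1 i) //= summxE (bigD1 j) //= !mxE.
rewrite !(coord_free _ _ (basis_free (vbasisP _))) !eqxx !mulr1.
rewrite !big1 ?addr0 // => [i' nii'|j' njj'].
  rewrite summxE big1 // => j' _; rewrite !mxE.
  rewrite !(coord_free _ _ (basis_free (vbasisP _))).
  by rewrite (negPf nii') mul0r mulr0.
rewrite !mxE !(coord_free _ _ (basis_free (vbasisP _))).
by rewrite (negPf njj') !mulr0.
Qed.

End Tensor.

Notation "u \ox v" := (tens u v) (at level 40, left associativity) : ring_scope.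

Definition tmap (k : fieldType) (U V U' V' : vectType k)
    (f : U -> U') (g : V -> V') : tensor U V -> tensor U' V' :=
  tlift (fun u v => f u \ox g v).

Lemma tmap_tens (k : fieldType) (U V U' V' : vectType k)
    (f : {linear U -> U'}) (g : {linear V -> V'}) (u : U) (v : V) :
  tmap f g (u \ox v) = f u \ox g v.
Proof.
have [bl br] := tens_bilin U' V'.
by apply: tlift_tens; split=> [y|x] a b c; rewrite /= linearP ?bl ?br.
Qed.

Definition tmul (k : fieldType) (A B : falgType k) (s t : tensor A B)
    : tensor A B :=
  tlift (fun a b => tlift (fun c d => (a * c) \ox (b * d)) t) s.

(* The image of A (x) B in U (x) V. *)
Definition tensv (k : fieldType) (U V : vectType k)
    (A : {vspace U}) (B : {vspace V}) : {vspace tensor U V} :=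
  <<[seq a \ox b | a <- vbasis A, b <- vbasis B]>>%VS.

Lemma memv_tensv (k : fieldType) (U V : vectType k)
    (A : {vspace U}) (B : {vspace V}) (t : tensor U V) :
  t \in tensv A B <-> exists s : tensor (subvs_of A) (subvs_of B),
    t = tmap vsval vsval s.
Proof.
have [bl br] := tens_bilin U V.
pose tl y : {linear U -> tensor U V} :=
  HB.pack (fun u : U => u \ox y) (GRing.isLinear.Build k U (tensor U V) _ _ (bl y)).
pose tr x : {linear V -> tensor U V} :=
  HB.pack (fun v : V => x \ox v) (GRing.isLinear.Build k V (tensor U V) _ _ (br x)).
have AB u v : u \in A -> v \in B -> u \ox v \in tensv A B.
  move=> Au Bv; rewrite (coord_vbasis Au) -[_ \ox v]/(tl v _) linear_sum.
  apply: memv_suml => i _; rewrite linearZ memvZ //=.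
  rewrite (coord_vbasis Bv) -[_ \ox _]/(tr _ _) linear_sum.
  apply: memv_suml => j _; rewrite linearZ memvZ //=.
  by apply: memv_span; apply: allpairs_f; rewrite mem_nth ?size_tuple.
split=> [|[s ->]]; last first.
  rewrite [tmap _ _ _]/tlift memv_suml // => i _; rewrite memv_suml // => j _.
  by rewrite memvZ // AB ?subvsP.
pose f : {linear tensor (subvs_of A) (subvs_of B) -> tensor U V} :=
  tlift (fun u v => vsval u \ox vsval v).
suffices /subvP/[apply] : (tensv A B <= limg (linfun f))%VS.
  by case/memv_imgP=> s _ ->; exists s; rewrite lfunE.
apply/span_subvP=> _ /allpairsP[[u v] /= [/vbasis_mem Au /vbasis_mem Bv ->]].
apply/memv_imgP; exists (vsproj A u \ox vsproj B v); rewrite ?memvf // lfunE.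
by rewrite [RHS](tmap_tens vsval vsval) /= !vsprojK.
Qed.

HB.mixin Record Falgebra_isHopf (k : fieldType) H of Falgebra k H := {
  comul : 'Hom(H, tensor H H);
  counit : 'Hom(H, k^o);
  antipode : 'End(H);
  comulA : forall h : H,
    tlift (fun a b => tlift (fun b1 b2 => (a \ox b1) \ox b2) (comul b)) (comul h)
    = tlift (fun a b => comul a \ox b) (comul h);
  comul_counitl : forall h : H, tlift (fun a b => counit a *: b) (comul h) = h;
  comul_counitr : forall h : H, tlift (fun a b => counit b *: a) (comul h) = h;
  comul1 : comul 1 = 1 \ox 1;
  comulM : forall a b : H, comul (a * b) = tmul (comul a) (comul b);
  counit1 : counit 1 = 1;
  counitM : forall a b : H, counit (a * b) = counit a * counit b;
  antipodel : forall h : H,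
    tlift (fun a b => antipode a * b) (comul h) = (counit h)%:A;
  antipoder : forall h : H,
    tlift (fun a b => a * antipode b) (comul h) = (counit h)%:A
}.

#[short(type="hopfAlgType")]
HB.structure Definition HopfAlgebra (k : fieldType) :=
  {H of Falgebra k H & Falgebra_isHopf k H}.

Section HopfAlgebraNotions.

Variables (k : fieldType) (H : hopfAlgType k).
Implicit Types (h : H) (C D K : {vspace H}).

Definition grouplike h : Prop := comul h = h \ox h /\ counit h = 1.

(* iota identifies the finite group gT with the group G(H). *)
Record grouplikes (gT : finGroupType) (iota : gT -> H) : Prop := Grouplikes {
  grouplikes_inj : injective iota;
  grouplikes1 : iota 1%g = 1;
  grouplikesM : {morph iota : a b / (a * b)%g >-> a * b};
  grouplikesP : forall h, grouplike h <-> exists a, iota a = h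
}.

Definition subcoalgebra D : Prop := (comul @: D <= tensv D D)%VS.

Definition simple_subcoalgebra D : Prop :=
  [/\ D != 0%VS, subcoalgebra D &
      forall C, (C <= D)%VS -> subcoalgebra C -> C = 0%VS \/ C = D].

(* The coradical is the sum of all simple subcoalgebras. *)
Definition in_coradical h : Prop :=
  exists2 s : seq {vspace H}, (forall D, D \in s -> simple_subcoalgebra D)
    & h \in (\sum_(D <- s) D)%VS.

Definition coradical_filtration (F : nat -> {vspace H}) : Prop :=
  (forall h, h \in F 0%N <-> in_coradical h) /\
  (forall n, F n.+1 = comul @^-1: (tensv fullv (F n) + tensv (F 0%N) fullv))%VS.

Definition pointed : Prop := forall D, simple_subcoalgebra D -> \dim D = 1%N.

Record hopf_grading (gr : nat -> {vspace H}) : Prop := HopfGrading {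
  hopf_grading_direct : forall N, directv (\sum_(n < N) gr n);
  hopf_grading_full : exists N, (\sum_(n < N) gr n)%VS = fullv;
  hopf_grading1 : 1 \in gr 0%N;
  hopf_gradingM : forall m n, (gr m * gr n <= gr (m + n)%N)%VS;
  hopf_grading_comul : forall n,
    (comul @: gr n <= \sum_(i < n.+1) tensv (gr i) (gr (n - i)%N))%VS;
  hopf_grading_counit : forall n h, (0 < n)%N -> h \in gr n -> counit h = 0;
  hopf_grading_antipode : forall n, (antipode @: gr n <= gr n)%VS
}.

Definition coradically_graded (gr : nat -> {vspace H}) : Prop :=
  hopf_grading gr /\
  coradical_filtration (fun n => \sum_(m < n.+1) gr m)%VS.

(* p is the projection H -> H_0 along the H_n, n >= 1, seen in End(H). *)
Definition graded_projection (gr : nat -> {vspace H}) (p : 'End(H)) : Prop :=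
  (forall h, h \in gr 0%N -> p h = h) /\
  (forall n h, (0 < n)%N -> h \in gr n -> p h = 0).

Definition coinvariants1 (gr : nat -> {vspace H}) (p : 'End(H)) : {vspace H} :=
  (gr 1%N :&: lker (linfun (fun h => tmap p id (comul h) - 1 \ox h)%R))%VS.

Lemma coinvariants1P gr p h : h \in coinvariants1 gr p <->
  h \in gr 1%N /\ tmap p id (comul h) = 1 \ox h.
Proof.
have [_ br] := tens_bilin H H.
pose tr : {linear H -> tensor H H} :=
  HB.pack (fun h => 1 \ox h : tensor H H)
    (GRing.isLinear.Build k H (tensor H H) _ _ (br 1)).
pose f : {linear tensor H H -> tensor H H} := tlift (fun a b => p a \ox b).
have -> : coinvariants1 gr p
    = (gr 1%N :&: lker (linfun (f \o comul \- tr)%R))%VS by [].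
rewrite memv_cap memv_ker lfunE /= subr_eq0.
by split=> [/andP[-> /eqP]|[-> ?]] //=; apply/eqP.
Qed.

Definition hopf_subalgebra K : Prop :=
  [/\ 1 \in K, (K * K <= K)%VS, subcoalgebra K & (antipode @: K <= K)%VS].

(* The product, unit and coproduct that a Hopf subalgebra K inherits from H.   *)
(* As [vsproj K] is the identity on K, they do not depend on its values        *)
(* outside K.                                                                  *)
Definition sub_one K : subvs_of K := vsproj K 1.

Definition sub_mul K (a b : subvs_of K) : subvs_of K :=
  vsproj K (vsval a * vsval b).

Definition sub_comul K (a : subvs_of K) : tensor (subvs_of K) (subvs_of K) :=
  tmap (vsproj K) (vsproj K) (comul (vsval a)).

Lemma sub_comulK K (a : subvs_of K) :
  subcoalgebra K -> tmap vsval vsval (sub_comul a) = comul (vsval a).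
Proof.
move/subvP/(_ _ (memv_img comul (subvsP a)))/memv_tensv=> [s comul_a].
rewrite /sub_comul comul_a; congr (tlift _ _).
rewrite [in RHS](tensE s) /tmap [X in tlift _ X]/tlift !linear_sum.
apply: eq_bigr => i _; rewrite !linear_sum; apply: eq_bigr => j _.
by rewrite linearZ /= -/(tmap _ _ _) tmap_tens /= !vsvalK.
Qed.

Section BraidedCentral.

Variables (K : {vspace H}) (r : 'Hom(tensor H (subvs_of K), k^o)).

Record braided_central_axioms : Prop := BraidedCentralAxioms {
  bc_hopf : hopf_subalgebra K;
  bc_mull : forall (h h' : H) (a : subvs_of K),
    r ((h * h') \ox a)
    = tlift (fun a1 a2 => r (h' \ox a1) * r (h \ox a2) : k^o) (sub_comul a);
  bc_mulr : forall (h : H) (a a' : subvs_of K),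
    r (h \ox sub_mul a a')
    = tlift (fun h1 h2 => r (h1 \ox a) * r (h2 \ox a') : k^o) (comul h);
  bc_onel : forall a : subvs_of K, r (1 \ox a) = counit (vsval a);
  bc_oner : forall h : H, r (h \ox sub_one K) = counit h;
  bc_braid : forall (h : H) (a : subvs_of K),
    tlift (fun h1 h2 => tlift (fun a1 a2 =>
        (r (h1 \ox a1) : k) *: (vsval a2 * h2 : H)) (sub_comul a)) (comul h)
    = tlift (fun h1 h2 => tlift (fun a1 a2 =>
        (r (h2 \ox a2) : k) *: (h1 * vsval a1 : H)) (sub_comul a)) (comul h);
  bc_sub : forall a a' : subvs_of K,
    r (vsval a \ox a') = counit (vsval a * vsval a')
}.

End BraidedCentral.

End HopfAlgebraNotions.

Record braided_central (k : fieldType) (H : hopfAlgType k) := BraidedCentral {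
  bc_space : {vspace H};
  bc_form : 'Hom(tensor H (subvs_of bc_space), k^o);
  bc_axioms : braided_central_axioms bc_form
}.

(* A multiplicative chi : gT -> k with chi 1 = 1 takes its values in k^*. *)
Record gdual (gT : finGroupType) (k : fieldType) := GDual {
  gdual_fun : {ffun gT -> k};
  _ : (gdual_fun 1%g == 1) &&
      [forall a, forall b, gdual_fun (a * b)%g == gdual_fun a * gdual_fun b]
}.

HB.instance Definition _ (gT : finGroupType) (k : fieldType) :=
  [isSub for @gdual_fun gT k].
HB.instance Definition _ (gT : finGroupType) (k : fieldType) :=
  [Choice of gdual gT k by <:].

Section Gdual.

Variables (gT : finGroupType) (k : fieldType).
Implicit Types (chi psi : gdual gT k) (a b : gT).

(* The evaluation <a, chi>. *)
Definition gpair a chi : k := gdual_fun chi a.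

Lemma gpair1l chi : gpair 1%g chi = 1.
Proof. by rewrite /gpair; case: chi => f /= /andP[/eqP]. Qed.

Lemma gpairMl chi a b : gpair (a * b)%g chi = gpair a chi * gpair b chi.
Proof.
by rewrite /gpair; case: chi => f /= /andP[_ /forallP/(_ a)/forallP/(_ b)/eqP].
Qed.

Lemma gpair_neq0 chi a : gpair a chi != 0.
Proof.
apply/eqP=> chia0; have /eqP := gpair1l chi.
by rewrite -(mulgV a) gpairMl chia0 mul0r eq_sym oner_eq0.
Qed.

Lemma gdualP chi psi : (forall a, gpair a chi = gpair a psi) -> chi = psi.
Proof. by move=> eq_cp; apply/val_inj/ffunP. Qed.

Fact gdual_one_subproof :
  let f := [ffun=> 1] : {ffun gT -> k} in
  (f 1%g == 1) && [forall a, forall b, f (a * b)%g == f a * f b].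
Proof.
by rewrite /= !ffunE eqxx; apply/forallP=> a; apply/forallP=> b;
  rewrite !ffunE mulr1.
Qed.

Definition gdual_one : gdual gT k := GDual gdual_one_subproof.

Fact gdual_inv_subproof chi :
  let f := [ffun a => (gpair a chi)^-1] : {ffun gT -> k} in
  (f 1%g == 1) && [forall a, forall b, f (a * b)%g == f a * f b].
Proof.
rewrite /= !ffunE gpair1l invr1 eqxx; apply/forallP=> a; apply/forallP=> b.
by rewrite !ffunE gpairMl invfM.
Qed.

Definition gdual_inv chi : gdual gT k := GDual (gdual_inv_subproof chi).

Fact gdual_mul_subproof chi psi :
  let f := [ffun a => gpair a chi * gpair a psi] : {ffun gT -> k} in
  (f 1%g == 1) && [forall a, forall b, f (a * b)%g == f a * f b].
Proof.
rewrite /= !ffunE !gpair1l mulr1 eqxx; apply/forallP=> a; apply/forallP=> b.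
by rewrite !ffunE !gpairMl mulrACA.
Qed.

Definition gdual_mul chi psi : gdual gT k := GDual (gdual_mul_subproof chi psi).

Lemma gpair1r a : gpair a gdual_one = 1.
Proof. by rewrite /gpair ffunE. Qed.

Lemma gpairVr a chi : gpair a (gdual_inv chi) = (gpair a chi)^-1.
Proof. by rewrite /gpair ffunE. Qed.

Lemma gpairMr a chi psi :
  gpair a (gdual_mul chi psi) = gpair a chi * gpair a psi.
Proof. by rewrite /gpair ffunE. Qed.

Fact gdual_mulA : associative gdual_mul.
Proof. by move=> x y z; apply: gdualP => a; rewrite !gpairMr mulrA. Qed.

Fact gdual_mul1 : left_id gdual_one gdual_mul.
Proof. by move=> x; apply: gdualP => a; rewrite gpairMr gpair1r mul1r. Qed.

Fact gdual_mulr1 : right_id gdual_one gdual_mul.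
Proof. by move=> x; apply: gdualP => a; rewrite gpairMr gpair1r mulr1. Qed.

Fact gdual_mulV : left_inverse gdual_one gdual_inv gdual_mul.
Proof.
move=> x; apply: gdualP => a.
by rewrite gpairMr gpairVr gpair1r mulVf ?gpair_neq0.
Qed.

Fact gdual_mulrV : right_inverse gdual_one gdual_inv gdual_mul.
Proof.
move=> x; apply: gdualP => a.
by rewrite gpairMr gpairVr gpair1r mulfV ?gpair_neq0.
Qed.

HB.instance Definition _ := isGroup.Build (gdual gT k)
  gdual_mulA gdual_mul1 gdual_mulr1 gdual_mulV gdual_mulrV.

End Gdual.

(* [subg_of G] is the subgroup G as a group type of its own, with inclusion    *)
(* [sgval] into gT.                                                            *)
Record central_pair (k : fieldType) (H : hopfAlgType k) (gT : finGroupType)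
    (iota : gT -> H) (theta : nat) (x : theta.-tuple H) (g : 'I_theta -> gT) :=
  CentralPair {
    cp_group : {group gT};
    cp_map : {ffun subg_of cp_group -> gdual gT k};
    cp_central : cp_group \subset 'Z([set: gT])%g;
    cp_morph : {morph cp_map : a b / (a * b)%g};
    cp_isotropic : forall a a' : subg_of cp_group,
      gpair (sgval a') (cp_map a) = 1;
    cp_action : forall (a : subg_of cp_group) (i : 'I_theta),
      iota (sgval a) * tnth x i * (iota (sgval a))^-1
      = gpair (g i) (cp_map a) *: tnth x i
  }.

(* (K, r) = (k G, <., Phi(.)> extended by zero in positive degrees). *)
Definition corresponds (k : fieldType) (H : hopfAlgType k) (gT : finGroupType)
    (iota : gT -> H) (theta : nat) (x : theta.-tuple H) (g : 'I_theta -> gT)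
    (gr : nat -> {vspace H})
    (P : central_pair iota x g) (B : braided_central H) : Prop :=
  [/\ bc_space B = <<[seq iota a | a in cp_group P]>>%VS,
      forall (c : gT) (a : subg_of (cp_group P)),
        bc_form B (iota c \ox vsproj (bc_space B) (iota (sgval a)))
        = gpair c (cp_map P a) &
      forall n h (b : subvs_of (bc_space B)),
        (0 < n)%N -> h \in gr n -> bc_form B (h \ox b) = 0].

(* Main.v *)
Require Import Defs.
From HB Require Import structures.
From mathcomp Require Import all_boot all_order all_fingroup all_algebra.
From mathcomp Require Import all_solvable all_field.
From Stdlib Require Import ProofIrrelevance IndefiniteDescription.

Set Implicit Arguments.
Unset Strict Implicit.
Unset Printing Implicit Defensive.

Import GRing.Theory.
Local Open Scope ring_scope.

(** Proof idea.  Let [(K, r)] be a braided central Hopf subalgebra.  For a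
    group-like [a] of [K] the form gives an algebra map [f_a = r(-, a)] on [H].
    It kills positive degrees, whose elements are nilpotent, and the braid axiom
    reads [a f_a(h_1) h_2 = h_1 f_a(h_2) a]; on group-likes this says that [a] is
    central, and on [x_i] it is the required commutation relation.

    It remains to see that [K] is spanned by group-likes.  If not, the coradical
    filtration and slices of the coproduct yield an element of [K] whose degree 1
    part [v] is nonzero and satisfies [Delta v = v (x) b + a (x) v] with [a], [b]
    group-likes of [K].  The braid axiom forces [v] to commute with [a] and [b],
    and then the powers of [a^-1 v] never vanish in characteristic 0.

    Conversely, the form built from [(G, Phi)] satisfies the braid axiom on a
    subalgebra containing [Gamma] and the [x_i], hence [H_1], hence all of [H].  *)

(** * Slices of the coproduct *)

Section Tlift.

Variable k : fieldType.
Implicit Types U V W : vectType k.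

Lemma eq_tlift U V W (F G : U -> V -> W) : F =2 G -> tlift F =1 tlift G.
Proof.
by move=> FG t; apply: eq_bigr => i _; apply: eq_bigr => j _; rewrite FG.
Qed.

Lemma linear_tlift U V W W' (f : {linear W -> W'}) (F : U -> V -> W) t :
  f (tlift F t) = tlift (fun u v => f (F u v)) t.
Proof.
rewrite /tlift linear_sum; apply: eq_bigr => i _.
by rewrite linear_sum; apply: eq_bigr => j _; rewrite linearZ.
Qed.

Lemma tlift_linear_fun U V W (c : k) (F G : U -> V -> W) t :
  tlift (fun u v => c *: F u v + G u v) t = c *: tlift F t + tlift G t.
Proof.
rewrite /tlift scaler_sumr -big_split; apply: eq_bigr => i _ /=.
rewrite scaler_sumr -big_split; apply: eq_bigr => j _ /=.
by rewrite scalerDr !scalerA mulrC.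
Qed.

Lemma tlift_sum_fun U V W (I : finType) (F : I -> U -> V -> W) t :
  tlift (fun u v => \sum_i F i u v) t = \sum_i tlift (F i) t.
Proof.
rewrite /tlift [RHS]exchange_big; apply: eq_bigr => i _ /=.
rewrite [RHS]exchange_big; apply: eq_bigr => j _ /=.
by rewrite scaler_sumr.
Qed.

Lemma tlift_sub_fun U V W (F G : U -> V -> W) t :
  tlift (fun u v => F u v - G u v) t = tlift F t - tlift G t.
Proof.
rewrite addrC -[- tlift G t]scaleN1r -tlift_linear_fun.
by apply: eq_tlift => u v; rewrite scaleN1r addrC.
Qed.

Lemma tlift_tensK U V (t : tensor U V) : tlift (@tens k U V) t = t.
Proof. by rewrite [RHS]tensE. Qed.

Lemma bilin_scalel U V W (f : {linear U -> k^o}) (g : {linear V -> W}) :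
  bilin (fun u v => (f u : k) *: g v).
Proof.
split=> [v|u] a x y; first by rewrite linearP /= scalerDl scalerA.
by rewrite linearP scalerDr !scalerA mulrC.
Qed.

Lemma bilin_scaler U V W (f : {linear V -> k^o}) (g : {linear U -> W}) :
  bilin (fun u v => (f v : k) *: g u).
Proof.
split=> [v|u] a x y; last by rewrite linearP /= scalerDl scalerA.
by rewrite linearP scalerDr !scalerA mulrC.
Qed.

Lemma bilin_mul U V (A : falgType k) (f : {linear U -> A}) (g : {linear V -> A}) :
  bilin (fun u v => f u * g v).
Proof.
split=> [v|u] a x y; first by rewrite linearP mulrDl scalerAl.
by rewrite linearP mulrDr scalerAr.
Qed.

Lemma bilin_tens U V U' V' (f : {linear U -> U'}) (g : {linear V -> V'}) :
  bilin (fun u v => f u \ox g v).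
Proof.
have [bl br] := tens_bilin U' V'.
by split=> [v|u] a x y; rewrite linearP ?bl ?br.
Qed.

Lemma bilin_sub U V W (F G : U -> V -> W) :
  bilin F -> bilin G -> bilin (fun u v => F u v - G u v).
Proof.
case=> Fl Fr [Gl Gr].
by split=> [v|u] a x y; rewrite ?Fl ?Fr ?Gl ?Gr scalerBr opprD addrACA.
Qed.

Lemma bilin_sum U V W (I : finType) (F : I -> U -> V -> W) :
  (forall i, bilin (F i)) -> bilin (fun u v => \sum_i F i u v).
Proof.
move=> bF; split=> [v|u] a x y; rewrite scaler_sumr -big_split /=;
  apply: eq_bigr => i _; have [Fl Fr] := bF i; by rewrite ?Fl ?Fr.
Qed.

Lemma tlift_mem U V W (F : U -> V -> W) (A : {vspace U}) (B : {vspace V})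
    (C : {vspace W}) t :
  bilin F -> (forall u v, u \in A -> v \in B -> F u v \in C) ->
  t \in tensv A B -> tlift F t \in C.
Proof.
move=> bF FAB tAB.
suffices /subvP/(_ t tAB) : (tensv A B <= linfun (tlift F) @^-1: C)%VS.
  by rewrite -memv_preim lfunE.
apply/span_subvP=> _ /allpairsP[[u v] /= [/vbasis_mem Au /vbasis_mem Bv ->]].
by rewrite -memv_preim lfunE /= tlift_tens ?FAB.
Qed.

Lemma mem_tens U V (A : {vspace U}) (B : {vspace V}) u v :
  u \in A -> v \in B -> u \ox v \in tensv A B.
Proof.
move=> Au Bv; apply/memv_tensv; exists (vsproj A u \ox vsproj B v).
by rewrite tmap_tens /= !vsprojK.
Qed.

Lemma tlift_tmul (A B : falgType k) W (F : A -> B -> W) (s t : tensor A B) :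
  bilin F ->
  tlift F (tmul s t) =
  tlift (fun a b => tlift (fun c d => F (a * c) (b * d)) t) s.
Proof.
move=> bF; rewrite /tmul [LHS]linear_tlift; apply: eq_tlift => a b.
by rewrite [LHS]linear_tlift; apply: eq_tlift => c d /=; rewrite tlift_tens.
Qed.

Lemma tlift_mulr U V (A : falgType k) (F : U -> V -> A) (c : A) t :
  tlift (fun u v => F u v * c) t = tlift F t * c.
Proof.
rewrite /tlift mulr_suml; apply: eq_bigr => i _.
by rewrite mulr_suml; apply: eq_bigr => j _; rewrite scalerAl.
Qed.

Lemma tlift_mull U V (A : falgType k) (F : U -> V -> A) (c : A) t :
  tlift (fun u v => c * F u v) t = c * tlift F t.
Proof.
rewrite /tlift mulr_sumr; apply: eq_bigr => i _.
by rewrite mulr_sumr; apply: eq_bigr => j _; rewrite scalerAr.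
Qed.

Lemma tlift_scaler U V W (F : U -> V -> W) (c : k) t :
  tlift (fun u v => c *: F u v) t = c *: tlift F t.
Proof.
rewrite /tlift scaler_sumr; apply: eq_bigr => i _.
by rewrite scaler_sumr; apply: eq_bigr => j _; rewrite !scalerA mulrC.
Qed.

Lemma bilin_tlift (U V U' V' W : vectType k) (F : U -> V -> U' -> V' -> W)
    (t : tensor U V) :
  (forall u v, bilin (F u v)) ->
  bilin (fun a b => tlift (fun u v => F u v a b) t).
Proof.
move=> bF; split=> [b|a] c x y; rewrite -tlift_linear_fun;
  by apply: eq_tlift => u v; have [bl br] := bF u v; rewrite ?bl ?br.
Qed.

Fact tensl_linear V W (w : W) : linear (fun v : V => v \ox w).
Proof. by have [bl _] := tens_bilin V W; apply: bl. Qed.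

Fact tensr_linear V W (v : V) : linear (fun w : W => v \ox w).
Proof. by have [_ br] := tens_bilin V W; apply: br. Qed.

Definition tensl V W (w : W) : {linear V -> tensor V W} :=
  HB.pack (fun v : V => v \ox w)
    (GRing.isLinear.Build k V (tensor V W) _ _ (@tensl_linear V W w)).

Definition tensr V W (v : V) : {linear W -> tensor V W} :=
  HB.pack (fun w : W => v \ox w)
    (GRing.isLinear.Build k W (tensor V W) _ _ (@tensr_linear V W v)).

Lemma tens_linearr V W (v : V) (c : k) (w w' : W) :
  v \ox (c *: w + w') = c *: (v \ox w) + v \ox w'.
Proof. exact: tensr_linear. Qed.

Lemma tens0l V W (w : W) : (0 : V) \ox w = 0.
Proof. exact: (linear0 (tensl V w)). Qed.

Lemma tens0r V W (v : V) : v \ox (0 : W) = 0.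
Proof. exact: (linear0 (tensr W v)). Qed.

Lemma tensv_line U (v : U) t : t \in tensv <[v]> <[v]> -> exists c, t = c *: (v \ox v).
Proof.
move=> tv; apply/vlineP; rewrite -(tlift_tensK t).
apply: tlift_mem tv; first exact: tens_bilin.
move=> _ _ /vlineP[a ->] /vlineP[b ->]; apply/vlineP; exists (a * b).
by apply/matrixP=> i j; rewrite !mxE !linearZ /= mulrACA.
Qed.

(* [coord X i] as a functional with values in [k^o] instead of [k]. *)
Definition coordf V n (X : n.-tuple V) (i : 'I_n) : 'Hom(V, k^o) :=
  let f : V -> k^o := coord X i in
  let fL : {linear V -> k^o} :=
    HB.pack f (GRing.isLinear.Build k V k^o _ f (coord_is_scalar X i)) in
  linfun fL.

Lemma coordfE V n (X : n.-tuple V) i v : coordf X i v = coord X i v.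
Proof. by rewrite lfunE. Qed.

Lemma exists_functional V (v : V) : v != 0 -> exists f : 'Hom(V, k^o), f v != 0.
Proof.
move=> v0; case: (boolP [exists i, coordf (vbasis fullv) i v != 0]).
  by case/existsP=> i; exists (coordf (vbasis fullv) i).
rewrite negb_exists => /forallP c0; case/eqP: v0.
rewrite (coord_vbasis (memvf v)) big1 // => i _.
by have := c0 i; rewrite negbK coordfE => /eqP->; rewrite scale0r.
Qed.

End Tlift.

Lemma subvs_span_ind (k : fieldType) (V : vectType k) (U : {vspace V})
    (s : seq V) (P : subvs_of U -> Prop) :
  U = <<s>>%VS ->
  (forall c u v, P u -> P v -> P (c *: u + v)) ->
  P 0 -> (forall v, v \in s -> P (vsproj _ v)) -> forall u, P u.
Proof.
move=> Us PD P0 Ps u; rewrite -(vsvalK u).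
have us : vsval u \in <<in_tuple s>>%VS by rewrite -Us subvsP.
rewrite (coord_span us) linear_sum; elim/big_ind: _ => // [v w Pv Pw|i _].
  by rewrite -[v]scale1r; apply: PD.
rewrite linearZ -[X in P X]addr0 /=; apply: PD => //; apply: Ps.
by rewrite mem_nth.
Qed.

Lemma amullE (k : fieldType) (A : falgType k) (u v : A) : amull u v = u * v.
Proof. by rewrite lfunE. Qed.

Lemma amulrE (k : fieldType) (A : falgType k) (u v : A) : amulr u v = v * u.
Proof. by rewrite lfunE. Qed.

Lemma span_mul_sub (k : fieldType) (A : falgType k) (s : seq A) (W : {vspace A}) :
  {in s &, forall u v, u * v \in W} -> (<<s>> * <<s>> <= W)%VS.
Proof.
move=> sW; apply/prodvP=> u v us vs; rewrite -amullE memv_preim.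
apply: (subvP _ v vs); apply/span_subvP=> w ws.
rewrite -memv_preim amullE -amulrE memv_preim.
apply: (subvP _ u us); apply/span_subvP=> z zs.
by rewrite -memv_preim amulrE sW.
Qed.

Section Slices.

Variables (k : fieldType) (H : hopfAlgType k).
Implicit Types (f : 'Hom(H, k^o)) (h u : H).

(** The maps [(f (x) id) Delta] and [(id (x) f) Delta], through which the coproduct is studied by
    endomorphisms of [H]. [conv] is the product of the dual algebra. *)
Definition lslice f : 'End(H) :=
  linfun (tlift (fun a b => (f a : k) *: b) \o comul).

Definition rslice f : 'End(H) :=
  linfun (tlift (fun a b => (f b : k) *: a) \o comul).

Definition conv f f' : 'Hom(H, k^o) :=
  linfun (tlift (fun a b => f a * f' b : k^o) \o comul).

Lemma lsliceE f h : lslice f h = tlift (fun a b => (f a : k) *: b) (comul h).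
Proof. by rewrite lfunE. Qed.

Lemma rsliceE f h : rslice f h = tlift (fun a b => (f b : k) *: a) (comul h).
Proof. by rewrite lfunE. Qed.

Lemma convE f f' h : conv f f' h = tlift (fun a b => f a * f' b : k^o) (comul h).
Proof. by rewrite lfunE. Qed.

Lemma lslice_counit h : lslice counit h = h.
Proof. by rewrite lsliceE comul_counitl. Qed.

Lemma rslice_counit h : rslice counit h = h.
Proof. by rewrite rsliceE comul_counitr. Qed.

Lemma lslice_grouplike f u : comul u = u \ox u -> lslice f u = (f u : k) *: u.
Proof. by move=> uP; rewrite lsliceE uP (tlift_tens _ _ (bilin_scalel f idfun)). Qed.

Lemma rslice_grouplike f u : comul u = u \ox u -> rslice f u = (f u : k) *: u.
Proof. by move=> uP; rewrite rsliceE uP (tlift_tens _ _ (bilin_scaler f idfun)). Qed.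

Lemma conv_grouplike f f' u : comul u = u \ox u -> conv f f' u = f u * f' u.
Proof. by move=> uP; rewrite convE uP (tlift_tens _ _ (bilin_scalel f f')). Qed.

Lemma lslice_sum (I : finType) (f : I -> 'Hom(H, k^o)) h :
  lslice (\sum_i f i) h = \sum_i lslice (f i) h.
Proof.
under [RHS]eq_bigr => i _ do rewrite lsliceE.
rewrite -tlift_sum_fun lsliceE; apply: eq_tlift => a b.
by rewrite sum_lfunE scaler_suml.
Qed.

Lemma rslice_sum (I : finType) (f : I -> 'Hom(H, k^o)) h :
  rslice (\sum_i f i) h = \sum_i rslice (f i) h.
Proof.
under [RHS]eq_bigr => i _ do rewrite rsliceE.
rewrite -tlift_sum_fun rsliceE; apply: eq_tlift => a b.
by rewrite sum_lfunE scaler_suml.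
Qed.

Lemma lsliceZ (c : k) f h : lslice (c *: f) h = c *: lslice f h.
Proof.
rewrite !lsliceE -tlift_scaler; apply: eq_tlift => a b.
by rewrite scale_lfunE scalerA.
Qed.

Lemma lslice0 h : lslice 0 h = 0.
Proof. by rewrite -(scale0r (0 : 'Hom(H, k^o))) lsliceZ scale0r. Qed.

(** Coassociativity evaluated at [f' (x) f (x) id]: left slices are a right action of the dual
    algebra, hence the reversed order. *)
Lemma lslice_lslice f f' h : lslice f (lslice f' h) = lslice (conv f' f) h.
Proof.
pose P : {linear tensor H H -> k^o} := tlift (fun a b => f' a * f b : k^o).
pose F (s : tensor H H) (b : H) := (P s : k) *: b.
have bF : bilin F by apply: (bilin_scalel P idfun).
have := congr1 (tlift F) (comulA h); rewrite !linear_tlift => FA.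
transitivity (tlift (fun a b => F (comul a) b) (comul h)); last first.
  by rewrite lsliceE; apply: eq_tlift => a b; rewrite /F lfunE.
rewrite lsliceE.
transitivity (tlift (fun a b => tlift F (comul a \ox b)) (comul h)); last first.
  by apply: eq_tlift => a b; rewrite tlift_tens.
rewrite -FA -lsliceE [lslice f' h]lsliceE linear_tlift.
apply: eq_tlift => a b; rewrite linear_tlift linearZ /= lsliceE -tlift_scaler.
apply: eq_tlift => b1 b2; rewrite tlift_tens // /F /P /=.
by rewrite (tlift_tens _ _ (bilin_scalel f' f)) scalerA.
Qed.

Lemma lslice_mulE f u h :
  lslice f (u * h) =
  tlift (fun a b => tlift (fun c d => (f (a * c) : k) *: (b * d)) (comul h))
    (comul u).
Proof. by rewrite lsliceE comulM tlift_tmul //; apply: (bilin_scalel f idfun). Qed.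

Lemma rslice_mulE f u h :
  rslice f (u * h) =
  tlift (fun a b => tlift (fun c d => (f (b * d) : k) *: (a * c)) (comul h))
    (comul u).
Proof. by rewrite rsliceE comulM tlift_tmul //; apply: (bilin_scaler f idfun). Qed.

Lemma lslice_mull f u v h :
  tlift (fun c d => (f (u * c) : k) *: (v * d)) (comul h) =
  v * lslice (f \o amull u)%VF h.
Proof.
rewrite lsliceE -tlift_mull; apply: eq_tlift => c d.
by rewrite comp_lfunE lfunE /= scalerAr.
Qed.

Lemma bilin_lslice_mul f h :
  bilin (fun a b =>
    tlift (fun c d => (f (a * c) : k) *: (b * d)) (comul h)).
Proof.
apply: bilin_tlift => c d.
pose F : {linear H -> k^o} := (f \o amulr c)%VF.
pose G : {linear H -> H} := amulr d.
split=> [b|a] e x y; have [bl br] := bilin_scalel F G.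
  by have := bl b e x y; rewrite /F /G /= !comp_lfunE !lfunE.
by have := br a e x y; rewrite /F /G /= !comp_lfunE !lfunE.
Qed.

Lemma lslice_mul_grouplike f u h : comul u = u \ox u ->
  lslice f (u * h) = u * lslice (f \o amull u)%VF h.
Proof.
by move=> uP; rewrite lslice_mulE uP (tlift_tens _ _ (bilin_lslice_mul f h)) lslice_mull.
Qed.

(** Here [Delta (u h) = (u (x) v + 1 (x) u) Delta h]. This twisted Leibniz rule is the recursion for
    slices of powers of a skew-primitive. *)
Lemma lslice_mul_skew f u v h : comul u = u \ox v + 1 \ox u ->
  lslice f (u * h) = v * lslice (f \o amull u)%VF h + u * lslice f h.
Proof.
move=> uP; rewrite lslice_mulE uP linearD /=.
by rewrite !(tlift_tens _ _ (bilin_lslice_mul f h)) !lslice_mull amull1 comp_lfun1r.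
Qed.

(** [Delta] and [f (x) id] are then both algebra maps. Multiplicative slices are what makes the
    solutions of the braid identity a subalgebra. *)
Lemma lsliceM f : {morph f : a b / a * b} -> {morph lslice f : a b / a * b}.
Proof.
move=> fM a b; rewrite lslice_mulE [lslice f a]lsliceE -tlift_mulr.
apply: eq_tlift => a1 a2; rewrite lslice_mull -scalerAl scalerAr; congr (_ * _).
rewrite !lsliceE -tlift_scaler; apply: eq_tlift => b1 b2.
by rewrite comp_lfunE lfunE /= fM scalerA.
Qed.

Lemma rsliceM f : {morph f : a b / a * b} -> {morph rslice f : a b / a * b}.
Proof.
move=> fM a b; rewrite rslice_mulE [rslice f a]rsliceE -tlift_mulr.
apply: eq_tlift => a1 a2; rewrite -scalerAl scalerAr rsliceE -tlift_scaler -tlift_mull.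
by apply: eq_tlift => b1 b2; rewrite fM -!scalerAr scalerA.
Qed.

Lemma comul_grouplike_mul (u v s t : H) :
  comul u = u \ox u -> comul v = v \ox s + t \ox v ->
  comul (u * v) = (u * v) \ox (u * s) + (u * t) \ox (u * v).
Proof.
move=> uP vP; rewrite comulM uP vP /tmul.
have b1 : bilin (fun c d : H => (u * c) \ox (u * d)).
  have := bilin_tens (amull u) (amull u).
  case=> bl br; split=> [w|w] a y z; [have := bl w a y z|have := br w a y z];
    by rewrite /= !amullE.
rewrite tlift_tens; first by rewrite linearD /= !tlift_tens.
apply: bilin_tlift => c d; have := bilin_tens (amulr c) (amulr d).
case=> bl br; split=> [w|w] a y z; [have := bl w a y z|have := br w a y z];
  by rewrite /= !amulrE.
Qed.

Lemma lslice_skew f (v s t : H) : comul v = v \ox s + t \ox v ->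
  lslice f v = (f v : k) *: s + (f t : k) *: v.
Proof.
by move=> vP; rewrite lsliceE vP linearD /= !(tlift_tens _ _ (bilin_scalel f idfun)).
Qed.

Lemma rslice_skew f (v s t : H) : comul v = v \ox s + t \ox v ->
  rslice f v = (f s : k) *: v + (f v : k) *: t.
Proof.
by move=> vP; rewrite rsliceE vP linearD /= !(tlift_tens _ _ (bilin_scaler f idfun)).
Qed.

Lemma lslice_mem f (D : {vspace H}) h :
  subcoalgebra D -> h \in D -> lslice f h \in D.
Proof.
move=> /subvP sD hD; rewrite lsliceE.
apply: tlift_mem (bilin_scalel f idfun) _ (sD _ (memv_img comul hD)).
by move=> u v _ vD; rewrite memvZ.
Qed.

Lemma rslice_mem f (D : {vspace H}) h :
  subcoalgebra D -> h \in D -> rslice f h \in D.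
Proof.
move=> /subvP sD hD; rewrite rsliceE.
apply: tlift_mem (bilin_scaler f idfun) _ (sD _ (memv_img comul hD)).
by move=> u v uD _; rewrite memvZ.
Qed.

End Slices.

(** * Gradings and group-likes *)

Definition degree0 (k : fieldType) (H : hopfAlgType k) (gr : nat -> {vspace H})
    (f : 'Hom(H, k^o)) : Prop :=
  forall n h, (0 < n)%N -> h \in gr n -> f h = 0.

Section Grading.

Variables (k : fieldType) (H : hopfAlgType k) (gr : nat -> {vspace H}).
Hypothesis grP : hopf_grading gr.

(** Directness of the first [n + 1] terms makes [gr n] meet the sum of the others trivially, and
    that sum is already the whole space. *)
Lemma hopf_grading_bounded N n :
  (\sum_(n < N) gr n)%VS = fullv -> (N <= n)%N -> gr n = 0%VS.
Proof.
move=> full leNn.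
have /directv_sumP/(_ ord_max isT) := hopf_grading_direct grP n.+1.
suffices -> : (\sum_(j < n.+1 | true && (j != ord_max)) gr j)%VS = fullv.
  by rewrite capvf.
apply/eqP; rewrite eqEsubv subvf -full; apply/subv_sumP => i _.
have lt_in : (i < n.+1)%N by rewrite ltnS ltnW // (leq_trans (ltn_ord i)).
apply: (sumv_sup (Ordinal lt_in)) => //=.
by rewrite -val_eqE /= ltn_eqF // (leq_trans (ltn_ord i)).
Qed.

Lemma hopf_grading_projections : exists pr : nat -> 'End(H),
  [/\ forall n h, pr n h \in gr n,
      forall m n h, h \in gr m -> pr n h = if n == m then h else 0 &
      exists N, forall h, h = \sum_(n < N) pr n h].
Proof.
have [N full] := hopf_grading_full grP.
have full' : fullv = (\sum_(0 <= n < N) gr n)%VS by rewrite big_mkord full.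
exists (sumv_pi_for full').
have mem n h : sumv_pi_for full' n h \in gr n by apply: memv_sum_pi.
have sum h : h = \sum_(n < N) sumv_pi_for full' n h.
  by rewrite -(big_mkord xpredT (fun n => sumv_pi_for full' n h)) sumv_pi_nat_sum ?memvf.
split=> // [m n h grh|]; last by exists N.
have gr0 := hopf_grading_bounded full.
have [leNm|ltmN] := leqP N m.
  by move: grh; rewrite gr0 // memv0 => /eqP->; rewrite linear0 if_same.
have [leNn|ltnN] := leqP N n.
  have /eqP-> : sumv_pi_for full' n h == 0 by rewrite -memv0 -(gr0 n).
  by case: eqP ltmN => // <-; rewrite ltnNge leNn.
(* The components of [h] are compared with the family having [h] in place [m] and zero elsewhere;
   both decompose [h] along a direct sum. *)
have /directv_sum_unique := hopf_grading_direct grP N.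
move/(_ (fun i => sumv_pi_for full' i h) (fun i : 'I_N => if i == m :> nat then h else 0)).
rewrite -sum (bigD1 (Ordinal ltmN)) //= eqxx big1 ?addr0 ?eqxx; last first.
  by move=> i; rewrite -val_eqE /= => /negPf->.
have mem_if i : (if i == m then h else 0) \in gr i.
  by case: eqP => [->|]; rewrite ?mem0v.
by move/(_ (fun i _ => mem i h) (fun i _ => mem_if i))/esym/forallP/(_ (Ordinal ltnN))/eqP.
Qed.

Lemma eq_linear_graded (W : vectType k) (F G : {linear H -> W}) :
  (forall n h, h \in gr n -> F h = G h) -> F =1 G.
Proof.
have [pr [mem _ [N sum]]] := hopf_grading_projections.
move=> FG h; rewrite (sum h) !linear_sum; apply: eq_bigr => i _.
exact: FG (mem i h).
Qed.

(** As [Delta] respects the grading, a Sweedler sum can be controlled on homogeneous pure tensors of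
    total degree [n]. With [C] zero this proves vanishing. *)
Lemma tlift_comul_mem (W : vectType k) (F : H -> H -> W) (C : {vspace W}) n h :
  bilin F -> h \in gr n ->
  (forall i j a b, (i + j = n)%N -> a \in gr i -> b \in gr j -> F a b \in C) ->
  tlift F (comul h) \in C.
Proof.
move=> bF grh FC.
have /subvP/(_ _ (memv_img comul grh))/memv_sumP[t tP ->] := hopf_grading_comul grP n.
rewrite linear_sum memv_suml // => i _; apply: tlift_mem (tP i isT) => // a b.
by apply: FC; rewrite subnKC // -ltnS.
Qed.

Lemma gr_mul m n a b : a \in gr m -> b \in gr n -> a * b \in gr (m + n)%N.
Proof. by move=> am bn; apply: (subvP (hopf_gradingM grP m n)); apply: memv_mul. Qed.

Lemma lslice_gr0 (f : 'Hom(H, k^o)) n h :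
  degree0 gr f ->
  h \in gr n -> lslice f h \in gr n.
Proof.
move=> f0 hn; rewrite lsliceE.
apply: (tlift_comul_mem (bilin_scalel f idfun) hn) => -[|i] j a b ij ai bj /=.
  by rewrite memvZ // -ij.
by rewrite (f0 i.+1) // scale0r mem0v.
Qed.

Lemma rslice_gr0 (f : 'Hom(H, k^o)) n h :
  degree0 gr f ->
  h \in gr n -> rslice f h \in gr n.
Proof.
move=> f0 hn; rewrite rsliceE.
apply: (tlift_comul_mem (bilin_scaler f idfun) hn) => i [|j] a b ij ai bj /=.
  by rewrite memvZ // -ij addn0.
by rewrite (f0 j.+1) // scale0r mem0v.
Qed.

End Grading.

Section Grouplikes.

Variables (k : fieldType) (H : hopfAlgType k).

(** If [u] is a combination of independent group-likes, comparing coefficients in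
    [comul u = u (x) u] makes its coefficients orthogonal idempotents of the field. Since [counit u]
    is nonzero, one of them is nonzero, hence 1; the others vanish and [u] is already in the
    list. *)
Lemma grouplike_free (s : seq H) :
  uniq s -> (forall u, u \in s -> grouplike u) -> free s.
Proof.
elim: s => [|u s IHs] /=; first by rewrite nil_free.
case/andP=> us uniqs gl; have {IHs} frs : free s.
  by apply: IHs => // v sv; apply: gl; rewrite inE sv orbT.
rewrite free_cons frs andbT; apply: contra us => u_s.
have [comul_u counit_u] := gl u (mem_head _ _).
have [n [X Xs]] : exists n (X : n.-tuple H), s = X by exists _, (in_tuple s).
have Xmem (i : 'I_n) : X`_i \in s by rewrite Xs mem_nth ?size_tuple.
move: frs u_s; rewrite Xs => frs u_s; pose c i : k := coordf X i u.
have uE : u = \sum_i c i *: X`_i.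
  rewrite [LHS](coord_span u_s); apply: eq_bigr => i _.
  by rewrite /c coordfE.
have glX (i : 'I_n) : grouplike X`_i by apply: gl; rewrite inE Xmem orbT.
(* Apply the product of two coordinates to comul u = u (x) u. *)
have cc i j : c i * c j = if i == j then c i else 0.
  pose F (a b : H) : k^o := coordf X i a * coordf X j b.
  have bF : bilin F by apply: (bilin_scalel (coordf X i) (coordf X j)).
  have := congr1 (tlift F) comul_u; rewrite tlift_tens // -[F u u]/(c i * c j) => <-.
  rewrite [in comul u]uE !linear_sum /= (bigD1 i) //= big1 ?addr0 => [|l li].
    rewrite !linearZ /= (glX i).1 /= tlift_tens // /F !coordfE !coord_free // eqxx mul1r.
    by case: eqP => _; rewrite ?scaler0 // /GRing.scale /= mulr1.
  rewrite !linearZ /= (glX l).1 /= tlift_tens // /F !coordfE !coord_free //.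
  by rewrite (negPf li) mul0r scaler0.
have [i ci0] : exists i, c i != 0.
  apply/existsP; rewrite -negb_forall; apply/negP => /forallP c0.
  move: counit_u; rewrite uE big1 => [|i _]; last by rewrite (eqP (c0 i)) scale0r.
  by rewrite linear0 => /eqP; rewrite eq_sym oner_eq0.
have ci1 : c i = 1 by apply: (mulfI ci0); rewrite cc eqxx mulr1.
suffices -> : u = X`_i by rewrite mem_nth ?size_tuple.
rewrite uE (bigD1 i) //= ci1 scale1r big1 ?addr0 // => j ji.
by have := cc i j; rewrite ci1 mul1r eq_sym (negPf ji) => ->; rewrite scale0r.
Qed.

Variables (gT : finGroupType) (iota : gT -> H).
Hypothesis iotaP : grouplikes iota.

Lemma comul_iota a : comul (iota a) = iota a \ox iota a.
Proof. by case: (proj2 (grouplikesP iotaP (iota a)) (ex_intro _ a erefl)). Qed.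

Lemma counit_iota a : counit (iota a) = 1.
Proof. by case: (proj2 (grouplikesP iotaP (iota a)) (ex_intro _ a erefl)). Qed.

Lemma iotaV a : iota a * iota a^-1%g = 1.
Proof. by rewrite -(grouplikesM iotaP) mulgV (grouplikes1 iotaP). Qed.

Lemma iotaVr a : iota a^-1%g * iota a = 1.
Proof. by rewrite -(grouplikesM iotaP) mulVg (grouplikes1 iotaP). Qed.

Lemma iota_unit a : iota a \is a GRing.unit.
Proof. by apply/unitrP; exists (iota a^-1%g); rewrite iotaV iotaVr. Qed.

Lemma iota_inv a : (iota a)^-1 = iota a^-1%g.
Proof. by rewrite -[RHS](mulKr (iota_unit a)) iotaV mulr1. Qed.

Lemma iota_free : free (codom iota).
Proof.
apply: grouplike_free => [|_ /codomP[a ->]]; last by apply/(grouplikesP iotaP); exists a.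
by rewrite map_inj_uniq ?enum_uniq //; apply: grouplikes_inj.
Qed.

End Grouplikes.

(** * Degrees 0 and 1 of a pointed coradically graded Hopf algebra *)

Section Pointed.

Variables (k : fieldType) (gT : finGroupType).
Variables (H : hopfAlgType k) (gr : nat -> {vspace H}).
Hypothesis gr_coradical : coradically_graded gr.
Hypothesis H_pointed : pointed H.
Variable iota : gT -> H.
Hypothesis iotaP : grouplikes iota.
Variable p : 'End(H).
Hypothesis pP : graded_projection gr p.

Let grP : hopf_grading gr := proj1 gr_coradical.

Lemma gr0_coradical h : h \in gr 0 <-> in_coradical h.
Proof. by have := proj1 (proj2 gr_coradical) h; rewrite big_ord1. Qed.

(** A group-like spans a one-dimensional, hence simple, subcoalgebra, and the degree 0 part is the
    coradical. *)
Lemma iota_gr0 a : iota a \in gr 0.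
Proof.
have a0 : iota a != 0.
  apply: contraTneq (iota_unit iotaP a) => ->; apply/negP => /unitrP[y [_]].
  by rewrite mul0r => /eqP; rewrite eq_sym oner_eq0.
apply/gr0_coradical; exists [:: <[iota a]>%VS]; last by rewrite big_seq1 memv_line.
move=> D; rewrite inE => /eqP->; split.
- by rewrite -dimv_eq0 dim_vline a0.
- rewrite /subcoalgebra limg_line comul_iota // -memvE.
  by rewrite mem_tens ?memv_line.
move=> C CD _; have := dimvS CD; rewrite dim_vline a0 leq_eqVlt => /orP[/eqP dC|].
  by right; apply/eqP; rewrite eqEdim CD dim_vline a0 dC.
by rewrite ltnS leqn0 dimv_eq0 => /eqP->; left.
Qed.

(** Pointedness makes a simple subcoalgebra a line. A generator [v] satisfies [Delta v = c v (x) v],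
    and the counit axiom forces [c * counit v = 1], so that [c *: v] is group-like. *)
Lemma gr0_span : gr 0 = <<codom iota>>%VS.
Proof.
apply/eqP; rewrite eqEsubv; apply/andP; split; last first.
  by apply/span_subvP=> _ /codomP[a ->]; apply: iota_gr0.
apply/subvP=> h /gr0_coradical[s sS hs].
suffices /subvP/(_ _ hs) : (\sum_(D <- s) D <= <<codom iota>>)%VS by [].
rewrite big_seq; elim/big_ind: _ => [|V W VS WS|D /sS simD].
- exact: sub0v.
- by rewrite subv_add VS.
have dD : \dim D = 1%N by apply: H_pointed.
have [D0 Dc _] := simD; pose v := vpick D.
have v0 : v != 0 by rewrite vpick0.
have DE : D = <[v]>%VS.
  apply/eqP; rewrite eq_sym eqEdim dD dim_vline v0 andbT -memvE; exact: memv_pick.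
move: Dc; rewrite /subcoalgebra DE limg_line -memvE => /tensv_line[c vc].
have := comul_counitl v.
rewrite vc linearZ /= (tlift_tens _ _ (bilin_scalel counit idfun)) scalerA /=.
move/eqP; rewrite -subr_eq0 -[X in _ - X]scale1r -scalerBl scaler_eq0 (negPf v0) orbF.
rewrite subr_eq0 => /eqP c1.
have c0 : c != 0 by apply: contra_eq_neq c1 => ->; rewrite mul0r eq_sym oner_neq0.
have /(grouplikesP iotaP)[a ea] : grouplike (c *: v).
  split; last by rewrite linearZ.
  by rewrite linearZ /= vc; apply/matrixP=> i j; rewrite !mxE !linearZ /= mulrACA !mulrA.
rewrite -[v](scalerK c0) -ea -memvE memvZ //.
by apply: memv_span; apply: codom_f.
Qed.

(** The coefficient of [iota a] in the degree 0 part. For [conv] these functionals are orthogonal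
    idempotents with sum [counit], so slices along them split [H] into weight components. *)
Definition gcoord (a : gT) : 'Hom(H, k^o) :=
  (coordf (codom_tuple iota) (enum_rank a) \o p)%VF.

Lemma graded_projection_gr0 h : p h \in gr 0.
Proof.
have [pr [mem idn [N sum]]] := hopf_grading_projections grP.
suffices /(_ h) -> : p =1 pr 0%N by [].
apply: (eq_linear_graded grP) => n u un; have [p0 p1] := pP.
rewrite /= (idn n) //; case: eqP un => [<- /p0 //|/eqP nz un].
by apply: p1 un; rewrite lt0n eq_sym.
Qed.

Lemma gcoord_iota a b : gcoord a (iota b) = (a == b)%:R.
Proof.
have [p0 _] := pP; rewrite comp_lfunE p0 ?iota_gr0 // coordfE.
have -> : iota b = (codom_tuple iota)`_(enum_rank b) by rewrite /= nth_codom enum_rankK.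
by rewrite coord_free ?(iota_free iotaP) // (inj_eq enum_rank_inj) eq_sym.
Qed.

Lemma gcoord_gr a : degree0 gr (gcoord a).
Proof.
by have [_ p1] := pP; move=> n h n0 hn; rewrite comp_lfunE (p1 n) // linear0.
Qed.

Lemma graded_projectionE h : p h = \sum_a (gcoord a h : k) *: iota a.
Proof.
have := graded_projection_gr0 h; rewrite gr0_span => /coord_span {1}->.
rewrite (reindex enum_rank) /=; last exact/onW_bij/enum_rank_bij.
by apply: eq_bigr => a _; rewrite comp_lfunE coordfE nth_codom enum_rankK.
Qed.

Lemma eq_linear_iota (W : vectType k) (F G : {linear H -> W}) :
  (forall a, F (iota a) = G (iota a)) ->
  (forall n h, (0 < n)%N -> h \in gr n -> F h = G h) -> F =1 G.
Proof.
move=> Fi Fg; apply: (eq_linear_graded grP) => -[|n] h hn; last exact: (Fg n.+1).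
have [p0 _] := pP; rewrite -(p0 h hn) graded_projectionE !linear_sum.
by apply: eq_bigr => a _; rewrite !linearZ Fi.
Qed.

Lemma sum_gcoord : \sum_a gcoord a = counit :> 'Hom(H, k^o).
Proof.
apply/lfunP; apply: eq_linear_iota => [a|n h n0 hn] /=.
  rewrite sum_lfunE (bigD1 a) //= big1 => [|b ba]; rewrite gcoord_iota ?(negPf ba) //.
  by rewrite eqxx addr0 counit_iota.
rewrite (hopf_grading_counit grP n0 hn) sum_lfunE big1 // => a _.
exact: gcoord_gr hn.
Qed.

Lemma gcoord_mul_iota a c : (gcoord c \o amull (iota a))%VF = gcoord (a^-1 * c)%g.
Proof.
apply/lfunP; apply: eq_linear_iota => [b|n h n0 hn] /=.
  rewrite comp_lfunE amullE /= -(grouplikesM iotaP) !gcoord_iota.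
  by rewrite eq_sym -(inj_eq (mulgI a^-1%g)) mulKg eq_sym.
rewrite comp_lfunE amullE /= (gcoord_gr _ n0 hn) (gcoord_gr _ n0) //.
by rewrite -[n]add0n (gr_mul grP) ?iota_gr0.
Qed.

Lemma conv_gr (f f' : 'Hom(H, k^o)) :
  degree0 gr f ->
  degree0 gr f' ->
  degree0 gr (conv f f').
Proof.
move=> f0 f'0 n h n0 hn; apply/eqP; rewrite -memv0 convE.
apply: (tlift_comul_mem grP (bilin_scalel f f') hn) => i j a b ij ai bj.
rewrite memv0 /=; case: i ij ai => [|i] ij ai; last by rewrite (f0 _ _ _ ai) // scale0r.
by rewrite (f'0 n) ?scaler0 // -ij.
Qed.

Lemma conv_gcoord a b : conv (gcoord a) (gcoord b) = (a == b)%:R *: gcoord a.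
Proof.
apply/lfunP; apply: eq_linear_iota => [c|n h n0 hn] /=.
  rewrite conv_grouplike ?comul_iota // scale_lfunE !gcoord_iota.
  case: (eqVneq a c) => [->|ac]; first by rewrite mul1r eq_sym [RHS]mulr1.
  by rewrite mul0r scaler0.
rewrite scale_lfunE (gcoord_gr _ n0 hn) scaler0.
exact: (conv_gr (gcoord_gr a) (gcoord_gr b) n0 hn).
Qed.

Lemma tmap_projection h :
  tmap p id (comul h) = \sum_a (iota a \ox lslice (gcoord a) h).
Proof.
transitivity (\sum_a tlift (fun u v => iota a \ox ((gcoord a u : k) *: v)) (comul h)).
  rewrite -tlift_sum_fun; apply: eq_tlift => u v /=; rewrite graded_projectionE.
  apply/matrixP=> i j; rewrite summxE !mxE linear_sum mulr_suml.
  by apply: eq_bigr => a _; rewrite !mxE !linearZ /= mulrAC mulrA mulrC mulrA.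
apply: eq_bigr => a _; rewrite lsliceE.
by rewrite -[RHS]/(tensr H (iota a) _) linear_tlift.
Qed.

(** The slice along [gcoord a] has weight [a] for the coaction [(p (x) id) Delta]; multiplying by
    the inverse of [a] brings the weight to 1, which is coinvariance. *)
Lemma gr1_slice h a : h \in gr 1 ->
  iota a^-1%g * lslice (gcoord a) h \in coinvariants1 gr p.
Proof.
move=> h1; apply/coinvariants1P; split.
  by rewrite -[1%N]add0n (gr_mul grP) ?iota_gr0 ?(lslice_gr0 grP (gcoord_gr a)).
rewrite tmap_projection (bigD1 1%g) //= big1 ?addr0 => [|b b1].
  rewrite (grouplikes1 iotaP) lslice_mul_grouplike ?comul_iota //.
  rewrite gcoord_mul_iota invgK mulg1 lslice_lslice conv_gcoord eqxx.
  by rewrite scale1r.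
rewrite lslice_mul_grouplike ?comul_iota // gcoord_mul_iota invgK.
rewrite lslice_lslice conv_gcoord.
have -> : (a == a * b)%g = false.
  by rewrite -{1}[a]mulg1 (inj_eq (mulgI a)) eq_sym (negPf b1).
by rewrite scale0r lslice0 mulr0; apply/matrixP=> i j; rewrite !mxE linear0 mulr0.
Qed.

Variables (theta : nat) (x : theta.-tuple H).
Hypothesis x_basis : basis_of (coinvariants1 gr p) x.

Lemma x_gr1 i : tnth x i \in gr 1.
Proof. by have /coinvariants1P[] := basis_mem x_basis (mem_tnth i x). Qed.

(** The degree 1 part of the bosonization: writing [counit] as the sum of the [gcoord a] splits [h]
    into weight components, each of which is [iota a] times a coinvariant. *)
Lemma gr1_sum h : h \in gr 1 ->
  exists c : gT -> 'I_theta -> k, h = \sum_a \sum_i c a i *: (iota a * tnth x i).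
Proof.
move=> h1; exists (fun a i => coord x i (iota a^-1%g * lslice (gcoord a) h)).
rewrite -[LHS]lslice_counit -sum_gcoord lslice_sum; apply: eq_bigr => a _.
rewrite -[LHS]mul1r -(iotaV iotaP a) -mulrA.
rewrite [X in iota a * X = _](coord_basis x_basis (gr1_slice a h1)) mulr_sumr.
by apply: eq_bigr => i _; rewrite -scalerAr -tnth_nth.
Qed.

End Pointed.

(** * Skew-primitive elements in characteristic zero *)

Section SkewPrimitive.
Variables (k : fieldType) (H : hopfAlgType k) (gr : nat -> {vspace H}).
Hypothesis grP : hopf_grading gr.

Lemma gr_exp m n h : h \in gr m -> h ^+ n \in gr (n * m)%N.
Proof.
move=> hm; elim: n => [|n IHn]; first by rewrite expr0 mul0n hopf_grading1.
by rewrite exprS mulSn (gr_mul grP).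
Qed.

Lemma gr_nilpotent m h : (0 < m)%N -> h \in gr m -> exists n, h ^+ n = 0.
Proof.
move=> m0 hm; have [N full] := hopf_grading_full grP; exists N.
apply/eqP; rewrite -memv0 -(hopf_grading_bounded grP full (leq_pmulr N m0)).
exact: gr_exp.
Qed.

(* For a functional f1 of degree 1, the slice of comul (y ^+ n) along f1 is
   n * f1 y * u * y ^+ (n - 1), so in characteristic 0 the least vanishing power
   of y can only be y ^+ 1. *)
Lemma skew_primitive_eq0 (y u : H) :
  [pchar k] =i pred0 -> y \in gr 1 -> comul y = y \ox u + 1 \ox y ->
  u \is a GRing.unit -> u * y = y * u -> y = 0.
Proof.
move=> /pcharf0P char0 y1 comul_y unit_u uy.
apply/eqP; apply/negPn/negP=> y0; have [f fy] := exists_functional y0.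
have [pr [mem idn [N sum]]] := hopf_grading_projections grP.
(* [f1] reads degree 1 and [f2], sending [h] to [f1 (y h)], reads degree 0. Multiplying twice by [y]
   reaches degree at least 2, so [f2 (y h) = 0]; this closes the recursion for [slice2], then for
   [slice1]. *)
pose f1 := (f \o pr 1%N)%VF; pose f2 := (f1 \o amull y)%VF.
have f2y0 : (f2 \o amull y)%VF = 0.
  apply/lfunP; apply: (eq_linear_graded grP) => n h hn.
  rewrite /= /f2 /f1 !comp_lfunE !amullE /= zero_lfunE.
  by rewrite (idn (1 + (1 + n))%N) ?linear0 // !(gr_mul grP).
have slice2 n : lslice f2 (y ^+ n) = (f y : k) *: y ^+ n.
  elim: n => [|n IHn].
    rewrite lslice_grouplike ?comul1 // /f2 /f1 !comp_lfunE amullE /=.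
    by rewrite mulr1 (idn 1%N).
  rewrite exprS (lslice_mul_skew _ _ comul_y) f2y0 lslice0 mulr0 add0r IHn.
  by rewrite scalerAr.
have slice1 n : lslice f1 (y ^+ n.+1) = (n.+1%:R * (f y : k)) *: (u * y ^+ n).
  elim: n => [|n IHn].
    rewrite expr1 -[y in LHS]mulr1 (lslice_mul_skew _ _ comul_y) (slice2 0%N).
    rewrite lslice_grouplike ?comul1 // comp_lfunE (idn 0%N) ?hopf_grading1 //=.
    by rewrite linear0 scale0r mulr0 addr0 -scalerAr mul1r.
  rewrite exprS (lslice_mul_skew _ _ comul_y) slice2 IHn -!scalerAr.
  rewrite mulrA -uy -mulrA -exprS -scalerDl [n.+2%:R]mulrS.
  by rewrite mulrDl mul1r.
have exn : exists n, y ^+ n == 0.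
  by have [n yn] := gr_nilpotent (ltn0Sn 0) y1; exists n; apply/eqP.
case: (ex_minnP exn) => -[|m] ym minm.
  by move: ym; rewrite expr0 oner_eq0.
have := slice1 m; rewrite (eqP ym) linear0 => /esym/eqP.
rewrite scaler_eq0 mulf_eq0 char0 (negPf fy) /=.
by rewrite mulrI_eq0 => [/minm|]; [rewrite ltnn | apply: mulrI].
Qed.
End SkewPrimitive.

(** * Functionals concentrated in degree 0 and the braid identity *)

Section Functionals.
Variables (k : fieldType) (gT : finGroupType).
Variables (H : hopfAlgType k) (gr : nat -> {vspace H}).
Hypothesis gr_coradical : coradically_graded gr.
Hypothesis H_pointed : pointed H.
Variable iota : gT -> H.
Hypothesis iotaP : grouplikes iota.
Variable p : 'End(H).
Hypothesis pP : graded_projection gr p.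
Let grP : hopf_grading gr := proj1 gr_coradical.
Let eq_linear_iota := eq_linear_iota gr_coradical H_pointed iotaP pP.
Let gcoord := gcoord iota p.

Definition gfun (chi : gT -> k) : 'Hom(H, k^o) := \sum_a chi a *: gcoord a.

Lemma gfun_iota chi a : gfun chi (iota a) = chi a.
Proof.
rewrite sum_lfunE (bigD1 a) //= big1 => [|b ba];
  rewrite scale_lfunE (gcoord_iota gr_coradical) //.
  by rewrite eqxx addr0 [LHS]mulr1.
by rewrite (negPf ba) scaler0.
Qed.

Lemma gfun_gr chi : degree0 gr (gfun chi).
Proof.
move=> n h n0 hn; rewrite sum_lfunE big1 // => a _.
by rewrite scale_lfunE (gcoord_gr iota pP a n0 hn) scaler0.
Qed.

Lemma eq_functional (f f' : 'Hom(H, k^o)) :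
  degree0 gr f ->
  degree0 gr f' ->
  (forall a, f (iota a) = f' (iota a)) -> f = f'.
Proof.
move=> f0 f'0 ff'; apply/lfunP; apply: eq_linear_iota => // n h n0 hn /=.
by rewrite (f0 n) // (f'0 n).
Qed.

(** Positive degrees form an ideal on which [f] vanishes, so a factor of positive degree makes both
    sides zero and only products of group-likes remain to be compared. *)
Lemma functional_mul (f : 'Hom(H, k^o)) :
  degree0 gr f ->
  (forall a b, f (iota (a * b)%g) = f (iota a) * f (iota b)) ->
  {morph f : a b / a * b}.
Proof.
move=> f0 fM u v.
have E w : (f \o amulr w)%VF u = (f w : k) *: f u; last first.
  by have := E v; rewrite comp_lfunE amulrE /= => ->; rewrite mulrC.
rewrite -scale_lfunE; apply: eq_linear_iota u => [a|m u m0 um] /=.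
  rewrite comp_lfunE amulrE /= scale_lfunE.
  transitivity ((f \o amull (iota a))%VF w); first by rewrite comp_lfunE amullE.
  transitivity (((f (iota a) : k) *: f) w); last by rewrite scale_lfunE [LHS]mulrC.
  apply: eq_linear_iota w => [b|n w n0 wn] /=.
    by rewrite comp_lfunE amullE /= -(grouplikesM iotaP) fM scale_lfunE.
  rewrite comp_lfunE amullE scale_lfunE (f0 n w) // scaler0 (f0 n) //.
  by rewrite -[n]add0n (gr_mul grP) ?(iota_gr0 gr_coradical iotaP).
rewrite scale_lfunE (f0 m u) // scaler0.
transitivity ((f \o amull u)%VF w); first by rewrite !comp_lfunE amullE amulrE.
transitivity ((0 : 'Hom(H, k^o)) w); last by rewrite zero_lfunE.
apply: (eq_linear_graded grP) w => n w wn /=.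
rewrite zero_lfunE comp_lfunE amullE (f0 (m + n)%N) ?addn_gt0 ?m0 //.
exact: (gr_mul grP).
Qed.

Lemma gfunM chi : (forall a b, chi (a * b)%g = chi a * chi b) ->
  {morph gfun chi : a b / a * b}.
Proof.
move=> chiM; apply: functional_mul => [|a b]; first exact: gfun_gr.
by rewrite !gfun_iota.
Qed.

Lemma functional_conv (f f' f'' : 'Hom(H, k^o)) :
  degree0 gr f ->
  degree0 gr f' ->
  degree0 gr f'' ->
  (forall a, f'' (iota a) = f (iota a) * f' (iota a)) -> conv f f' = f''.
Proof.
move=> f0 f'0 f''0 E; apply: eq_functional => // [|a].
  exact: (conv_gr gr_coradical f0 f'0).
by rewrite conv_grouplike ?comul_iota ?E.
Qed.

Variables (theta : nat) (x : theta.-tuple H) (g : 'I_theta -> gT).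
Hypothesis x_basis : basis_of (coinvariants1 gr p) x.
Hypothesis comul_x : forall i : 'I_theta,
     comul (tnth x i) = tnth x i \ox iota (g i) + 1 \ox tnth x i.
Hypothesis H_generated : agenv (<<[seq iota a | a : gT]>> + gr 1%N)%VS = fullv.

(** Both slices along [f] are multiplicative, so the solutions [h] form a subalgebra. At a
    group-like the identity is commutation with [u]; at [x_i], where [f] vanishes, it is the
    relation assumed between [u] and [x_i]. *)
Lemma braid_functional (f : 'Hom(H, k^o)) (u : H) :
  {morph f : a b / a * b} -> f 1 = 1 ->
  degree0 gr f ->
  (forall a, u * iota a = iota a * u) ->
  (forall i, u * tnth x i = (f (iota (g i)) : k) *: (tnth x i * u)) ->
  forall h, u * lslice f h = rslice f h * u.
Proof.
move=> fM f1 f0 uc ux h.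
pose F1 := (amull u \o lslice f)%VF; pose F2 := (amulr u \o rslice f)%VF.
pose W := lker (F1 - F2).
have WP v : reflect (u * lslice f v = rslice f v * u) (v \in W).
  apply: (iffP eqlfunP); rewrite /F1 /F2 !comp_lfunE amullE amulrE //.
have WM v w : v \in W -> w \in W -> v * w \in W.
  move=> /WP vW /WP wW; apply/WP; rewrite lsliceM // rsliceM //.
  by rewrite mulrA vW -!mulrA wW.
have Wi a : iota a \in W.
  apply/WP; rewrite lslice_grouplike ?rslice_grouplike ?comul_iota //.
  by rewrite -scalerAl -scalerAr uc.
have Wx i : tnth x i \in W.
  apply/WP; rewrite (lslice_skew _ (comul_x i)) (rslice_skew _ (comul_x i)) f1.
  rewrite (f0 1%N _ _ (x_gr1 x_basis i)) //.
  by rewrite !scale0r scale1r add0r addr0 -scalerAl.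
apply/WP; suffices /subvP/(_ h (memvf h)) : (fullv <= W)%VS by [].
(* Since [W] contains 1, stability under left multiplication by the generators is enough. *)
rewrite -H_generated; apply: agenv_sub_modl.
  by rewrite -memvE -(grouplikes1 iotaP).
apply/prodvP => v w vU wW; apply: (WM) => //.
suffices /subvP/(_ v vU) : (<<codom iota>> + gr 1 <= W)%VS by [].
rewrite subv_add; apply/andP; split; first by apply/span_subvP=> _ /codomP[a ->].
apply/subvP=> y /(gr1_sum gr_coradical H_pointed iotaP pP x_basis)[c ->].
rewrite memv_suml // => a _; rewrite memv_suml // => i _; rewrite memvZ // WM //.
Qed.

End Functionals.

(** * From pairs to forms *)

Section Forms.
Variables (k : fieldType) (H : hopfAlgType k) (K : {vspace H}).
Implicit Types (r : 'Hom(tensor H (subvs_of K), k^o)) (b : subvs_of K).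

Definition lform r b : 'Hom(H, k^o) := (r \o linfun (tensl H b))%VF.

Lemma lformE r b h : lform r b h = r (h \ox b).
Proof. by rewrite comp_lfunE lfunE. Qed.

Definition rform r h : 'Hom(subvs_of K, k^o) := (r \o linfun (tensr (subvs_of K) h))%VF.

Lemma rformE r b h : rform r h b = r (h \ox b).
Proof. by rewrite comp_lfunE lfunE. Qed.

Lemma sub_comul_linear : linear (@sub_comul k H K).
Proof. by move=> c a b; rewrite /sub_comul /tmap !linearP. Qed.

Lemma sub_comul_grouplike u : comul u = u \ox u -> u \in K ->
  sub_comul (vsproj K u) = vsproj K u \ox vsproj K u.
Proof. by move=> uP uK; rewrite /sub_comul vsprojK // uP tmap_tens. Qed.

(** At a group-like [b] the Sweedler sum over [K] has a single term, and this side of the braid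
    axiom becomes a slice of [h]; [braid_right] treats the other side. *)
Lemma braid_left r b h : sub_comul b = b \ox b ->
  tlift (fun h1 h2 => tlift (fun a1 a2 =>
        (r (h1 \ox a1) : k) *: (vsval a2 * h2 : H)) (sub_comul b)) (comul h)
  = vsval b * lslice (lform r b) h.
Proof.
move=> bP; rewrite lsliceE -tlift_mull; apply: eq_tlift => h1 h2; rewrite bP.
pose F : {linear subvs_of K -> k^o} := rform r h1.
pose G : {linear subvs_of K -> H} := (amulr h2 \o linfun vsval)%VF.
have bF := bilin_scalel F G.
transitivity (tlift (fun a1 a2 => (F a1 : k) *: G a2) (b \ox b)).
  by apply: eq_tlift => a1 a2; rewrite /F /G /= rformE comp_lfunE amulrE lfunE.
by rewrite tlift_tens // /F /G /= rformE lformE comp_lfunE amulrE lfunE scalerAr.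
Qed.

Lemma braid_right r b h : sub_comul b = b \ox b ->
  tlift (fun h1 h2 => tlift (fun a1 a2 =>
        (r (h2 \ox a2) : k) *: (h1 * vsval a1 : H)) (sub_comul b)) (comul h)
  = rslice (lform r b) h * vsval b.
Proof.
move=> bP; rewrite rsliceE -tlift_mulr; apply: eq_tlift => h1 h2; rewrite bP.
pose F : {linear subvs_of K -> k^o} := rform r h2.
pose G : {linear subvs_of K -> H} := (amull h1 \o linfun vsval)%VF.
have bF := bilin_scaler F G.
transitivity (tlift (fun a1 a2 => (F a2 : k) *: G a1) (b \ox b)).
  by apply: eq_tlift => a1 a2; rewrite /F /G /= rformE comp_lfunE amullE lfunE.
by rewrite tlift_tens // /F /G /= rformE lformE comp_lfunE amullE lfunE scalerAl.
Qed.

Lemma convl_grouplike r b h h' : sub_comul b = b \ox b ->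
  tlift (fun a1 a2 => r (h' \ox a1) * r (h \ox a2) : k^o) (sub_comul b)
  = lform r b h' * lform r b h.
Proof.
move=> ->; have bF := bilin_scalel (rform r h') (rform r h).
rewrite !lformE -!rformE -[RHS]/(_ *: _) -(tlift_tens b b bF).
by apply: eq_tlift => a1 a2; rewrite -!rformE.
Qed.

Lemma convr_form r b b' h :
  tlift (fun h1 h2 => r (h1 \ox b) * r (h2 \ox b') : k^o) (comul h)
  = conv (lform r b) (lform r b') h.
Proof. by rewrite convE; apply: eq_tlift => u v; rewrite !lformE. Qed.

End Forms.

Section GroupAlgebra.
Variables (k : fieldType) (gT : finGroupType) (H : hopfAlgType k).
Variable iota : gT -> H.
Hypothesis iotaP : grouplikes iota.

Lemma antipode_iota a : antipode (iota a) = iota a^-1%g.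
Proof.
pose F (u v : H) := antipode u * v.
have bF : bilin F by apply: (bilin_mul (antipode : {linear H -> H}) idfun).
have := antipodel (iota a); rewrite comul_iota // (tlift_tens _ _ bF) /F counit_iota //.
rewrite scale1r => /(congr1 (fun u => u * iota a^-1%g)).
by rewrite mul1r -mulrA iotaV // mulr1.
Qed.

Variable G : {group gT}.

Lemma iota_span a : a \in G -> iota a \in <<[seq iota c | c in G]>>%VS.
Proof. by move=> aG; apply/memv_span/imageP; exists a. Qed.

Lemma group_hopf_subalgebra : hopf_subalgebra <<[seq iota a | a in G]>>%VS.
Proof.
split.
- by rewrite -(grouplikes1 iotaP) iota_span.
- apply: span_mul_sub => _ _ /imageP[a aG ->] /imageP[b bG ->].
  by rewrite -(grouplikesM iotaP) iota_span // groupM.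
- rewrite /subcoalgebra limg_span; apply/span_subvP=> _ /mapP[_ /imageP[a aG ->] ->].
  by rewrite comul_iota // mem_tens // iota_span.
rewrite limg_span; apply/span_subvP=> _ /mapP[_ /imageP[a aG ->] ->].
by rewrite antipode_iota iota_span // groupV.
Qed.

End GroupAlgebra.

Section FromPair.
Variables (k : fieldType) (gT : finGroupType).
Variables (H : hopfAlgType k) (gr : nat -> {vspace H}).
Hypothesis gr_coradical : coradically_graded gr.
Hypothesis H_pointed : pointed H.
Variable iota : gT -> H.
Hypothesis iotaP : grouplikes iota.
Variable p : 'End(H).
Hypothesis pP : graded_projection gr p.
Let grP : hopf_grading gr := proj1 gr_coradical.
Variables (theta : nat) (x : theta.-tuple H) (g : 'I_theta -> gT).
Hypothesis x_basis : basis_of (coinvariants1 gr p) x.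
Hypothesis comul_x : forall i : 'I_theta,
     comul (tnth x i) = tnth x i \ox iota (g i) + 1 \ox tnth x i.
Hypothesis H_generated : agenv (<<[seq iota a | a : gT]>> + gr 1%N)%VS = fullv.

Variable P : central_pair iota x g.
Let G := cp_group P.
Let Phi := cp_map P.
Let K := <<[seq iota a | a in G]>>%VS.

Definition pair_functional (s : subg_of G) : 'Hom(H, k^o) :=
  gfun iota p (fun a => gpair a (Phi s)).
Let rho := pair_functional.

Let iotaK (s : subg_of G) : subvs_of K := vsproj K (iota (sgval s)).

Let vsval_iotaK s : vsval (iotaK s) = iota (sgval s).
Proof. by rewrite vsprojK // iota_span // subgP. Qed.

Let rhoE s a : rho s (iota a) = gpair a (Phi s).
Proof. by rewrite /rho /pair_functional (gfun_iota gr_coradical iotaP pP). Qed.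

Let rho0 s : degree0 gr (rho s).
Proof. exact: (gfun_gr iota pP). Qed.

Let rhoM s : {morph rho s : a b / a * b}.
Proof.
by apply: (gfunM gr_coradical H_pointed iotaP pP) => a b; rewrite gpairMl.
Qed.

Let rho_mul s t : conv (rho s) (rho t) = rho (s * t)%g.
Proof.
apply: (functional_conv gr_coradical H_pointed iotaP pP); try exact: rho0.
by move=> a; rewrite !rhoE /Phi cp_morph gpairMr.
Qed.

Let rho1 : rho 1%g = counit.
Proof.
apply: (eq_functional gr_coradical H_pointed iotaP pP) => [||a].
- exact: rho0.
- by move=> n h; apply: (hopf_grading_counit grP).
(* The values of [Phi 1] are idempotent, as [Phi 1 * Phi 1 = Phi 1], and nonzero, hence 1. *)
rewrite rhoE counit_iota //; apply: (mulfI (gpair_neq0 (Phi 1%g) a)).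
by rewrite mulr1 -gpairMr -[gdual_mul _ _]/(Phi 1 * Phi 1)%g -cp_morph mulg1.
Qed.

(** The group-likes of [G] form a basis of [K] in which [gcoord] reads the coordinates: [b] is
    expanded and each group-like replaced by its functional. *)
Definition pair_form_fun (h : H) (b : subvs_of K) : k^o :=
  \sum_(s : subg_of G) (gcoord iota p (sgval s) (vsval b) : k) *: rho s h.

Definition pair_form : 'Hom(tensor H (subvs_of K), k^o) :=
  linfun (tlift pair_form_fun).
Let r := pair_form.

Let rE h b : r (h \ox b) = pair_form_fun h b.
Proof.
rewrite lfunE /= tlift_tens //; apply: bilin_sum => s.
pose c : {linear subvs_of K -> k^o} := (gcoord iota p (sgval s) \o linfun vsval)%VF.
have [bl br] := bilin_scaler c (rho s).
split=> [v|u] a y z.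
  by have := bl v a y z; rewrite /c /= comp_lfunE [linfun _ v]lfunE.
by have := br u a y z; rewrite /c /= !comp_lfunE ![linfun _ _]lfunE.
Qed.

Let r_iota h s : r (h \ox iotaK s) = rho s h.
Proof.
rewrite rE /pair_form_fun (bigD1 s) //= vsval_iotaK big1 => [|t ts].
  by rewrite (gcoord_iota gr_coradical iotaP pP) eqxx scale1r addr0.
rewrite (gcoord_iota gr_coradical iotaP pP) (inj_eq (@subg_inj _ _)) (negPf ts).
by rewrite scale0r.
Qed.

Let lform_iota s : lform r (iotaK s) = rho s.
Proof. by apply/lfunP=> h; rewrite lformE r_iota. Qed.

Let indK (Q : subvs_of K -> Prop) :
  (forall c u v, Q u -> Q v -> Q (c *: u + v)) -> (forall s, Q (iotaK s)) ->
  forall b, Q b.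
Proof.
move=> QD Qs; apply: (subvs_span_ind (erefl K)) => // [|_ /imageP[a aG ->]].
  by have := QD (-1) _ _ (Qs 1%g) (Qs 1%g); rewrite scaleN1r addNr.
by have := Qs (Subg aG).
Qed.

Let sub_comul_iotaK s : sub_comul (iotaK s) = iotaK s \ox iotaK s.
Proof. by rewrite sub_comul_grouplike ?comul_iota ?iota_span ?subgP. Qed.

Let sub_mul_iotaK s t : sub_mul (iotaK s) (iotaK t) = iotaK (s * t)%g.
Proof. by rewrite /sub_mul !vsval_iotaK -(grouplikesM iotaP). Qed.

(** The axioms are linear in each argument from [K], so [indK] reduces them to group-likes. There
    the product axioms say that [rho s] is multiplicative and that [rho] turns products into
    convolutions, and the last axiom is the isotropy of [Phi]. *)
Lemma pair_form_axioms : braided_central_axioms r.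
Proof.
split.
- exact: group_hopf_subalgebra.
- move=> h h'; apply: indK => [c u v Qu Qv|s].
    by rewrite tens_linearr linearP sub_comul_linear [RHS]linearP /= Qu Qv.
  by rewrite convl_grouplike // lform_iota r_iota rhoM mulrC.
- move=> h a a'; move: a; apply: indK => [c u v Qu Qv|s].
    have -> : sub_mul (c *: u + v) a' = c *: sub_mul u a' + sub_mul v a'.
      by rewrite /sub_mul linearP mulrDl -scalerAl linearP.
    rewrite tens_linearr linearP /= Qu Qv -tlift_linear_fun; apply: eq_tlift => h1 h2.
    by rewrite tens_linearr linearP mulrDl scalerAl.
  move: a'; apply: indK => [c u v Qu Qv|t].
    have -> : sub_mul (iotaK s) (c *: u + v) =
        c *: sub_mul (iotaK s) u + sub_mul (iotaK s) v.
      by rewrite /sub_mul linearP mulrDr -scalerAr linearP.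
    rewrite tens_linearr linearP /= Qu Qv -tlift_linear_fun; apply: eq_tlift => h1 h2.
    by rewrite tens_linearr linearP mulrDr scalerAr.
  by rewrite convr_form !lform_iota rho_mul sub_mul_iotaK r_iota.
- apply: indK => [c u v Qu Qv|s]; first by rewrite tens_linearr !linearP /= Qu Qv.
  rewrite r_iota vsval_iotaK counit_iota // -(grouplikes1 iotaP) rhoE.
  by rewrite gpair1l.
- move=> h; rewrite -rho1 -r_iota; congr (r (h \ox _)).
  by rewrite /sub_one -(grouplikes1 iotaP).
- move=> h; apply: indK => [c u v Qu Qv|s].
    rewrite sub_comul_linear.
    transitivity (c *: tlift (fun h1 h2 => tlift (fun a1 a2 =>
        (r (h1 \ox a1) : k) *: (vsval a2 * h2 : H)) (sub_comul u)) (comul h)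
      + tlift (fun h1 h2 => tlift (fun a1 a2 =>
        (r (h1 \ox a1) : k) *: (vsval a2 * h2 : H)) (sub_comul v)) (comul h)).
      by rewrite -tlift_linear_fun; apply: eq_tlift => h1 h2; rewrite linearP.
    rewrite Qu Qv -tlift_linear_fun; apply: eq_tlift => h1 h2.
    by rewrite linearP.
  rewrite braid_left // braid_right // lform_iota vsval_iotaK.
  apply: (braid_functional gr_coradical H_pointed iotaP pP x_basis comul_x H_generated).
  + exact: rhoM.
  + by rewrite -(grouplikes1 iotaP) rhoE gpair1l.
  + exact: rho0.
  + move=> a; rewrite -!(grouplikesM iotaP); congr iota.
    have /centerP[_ cs] := subsetP (cp_central P) _ (subgP s).
    by apply: cs; rewrite inE.
  (* The conjugation relation of the pair, multiplied on the right by [iota (sgval s)], is the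
     relation asked by [braid_functional]. *)
  move=> i; rewrite rhoE; have := cp_action s i.
  move/(congr1 (fun u => u * iota (sgval s))).
  by rewrite mulrVK ?iota_unit // scalerAl.
move=> a a'; move: a; apply: indK => [c u v Qu Qv|s].
  rewrite -[LHS]lformE linearP mulrDl -scalerAl !linearP /= -Qu -Qv.
  by rewrite !lformE.
move: a'; apply: indK => [c u v Qu Qv|t].
  by rewrite tens_linearr !linearP /= mulrDr -scalerAr !linearP /= Qu Qv.
rewrite r_iota !vsval_iotaK rhoE -(grouplikesM iotaP) counit_iota //.
by rewrite cp_isotropic.
Qed.

Lemma exists_corresponding_form : exists B, corresponds gr P B.
Proof.
exists (BraidedCentral pair_form_axioms); split=> // [c a|n h b n0 hn] /=.
  by rewrite r_iota rhoE.
rewrite -/r rE /pair_form_fun big1 // => s _.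
by rewrite (rho0 s n0 hn) scaler0.
Qed.

End FromPair.

(** * From forms to pairs *)

Section DegreeOne.
Variables (k : fieldType) (H : hopfAlgType k).

Variables (gr : nat -> {vspace H}).
Hypothesis grP : hopf_grading gr.
Variable pr : nat -> 'End(H).
Hypothesis prE : forall m n h, h \in gr m -> pr n h = if n == m then h else 0.
Hypothesis pr_sum : exists N, forall h, h = \sum_(n < N) pr n h.
Hypothesis pr_mem : forall n h, pr n h \in gr n.

(** Pairing the second factor with a functional of degree [q] lowers degrees by [q], so the degree
    [i] part of the slice only sees the degree [i + q] part of [h]. *)
Lemma pr_rslice (f : 'Hom(H, k^o)) q i h :
  pr i (rslice (f \o pr q)%VF h) = pr i (rslice (f \o pr q)%VF (pr (i + q)%N h)).
Proof.
pose A := (pr i \o rslice (f \o pr q))%VF.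
suffices /(_ h) : A =1 (A \o pr (i + q)%N)%VF by rewrite /A !comp_lfunE.
apply: (eq_linear_graded grP) => n {}h hn /=.
rewrite [RHS]comp_lfunE (prE _ hn); case: eqP => // iqn.
rewrite linear0 /A comp_lfunE rsliceE linear_tlift.
have bF := bilin_scaler (f \o pr q)%VF (pr i).
transitivity (tlift (fun a b => ((f \o pr q)%VF b : k) *: pr i a) (comul h)).
  by apply: eq_tlift => a b; rewrite linearZ.
apply/eqP; rewrite -memv0; apply: (tlift_comul_mem grP bF hn) => i' j a b ij ai bj.
rewrite /= comp_lfunE (prE _ ai) (prE _ bj).
case: eqP => [qj|_]; last by rewrite linear0 scale0r mem0v.
case: eqP => [ii|_]; last by rewrite scaler0 mem0v.
by case: iqn; rewrite -ij ii qj.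
Qed.

Lemma pr_lslice0 (f : 'Hom(H, k^o)) :
  degree0 gr f ->
  forall i h, pr i (lslice f h) = lslice f (pr i h).
Proof.
move=> f0 i h; pose L := (pr i \o lslice f)%VF; pose R := (lslice f \o pr i)%VF.
suffices /(_ h) : L =1 R by rewrite /L /R !comp_lfunE.
apply: (eq_linear_graded grP) => n {}h hn /=.
rewrite /L /R !comp_lfunE (prE _ hn) (prE _ (lslice_gr0 grP f0 hn)).
by case: eqP; rewrite ?linear0.
Qed.

Lemma pr_rslice0 (f : 'Hom(H, k^o)) :
  degree0 gr f ->
  forall i h, pr i (rslice f h) = rslice f (pr i h).
Proof.
move=> f0 i h; pose L := (pr i \o rslice f)%VF; pose R := (rslice f \o pr i)%VF.
suffices /(_ h) : L =1 R by rewrite /L /R !comp_lfunE.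
apply: (eq_linear_graded grP) => n {}h hn /=.
rewrite /L /R !comp_lfunE (prE _ hn) (prE _ (rslice_gr0 grP f0 hn)).
by case: eqP; rewrite ?linear0.
Qed.

Lemma low_split h : (forall i, (1 < i)%N -> pr i h = 0) -> h = pr 0%N h + pr 1%N h.
Proof.
move=> h0; have [N sum] := pr_sum.
apply/eqP; rewrite -subr_eq0 (sum (h - _)) big1 // => n _.
rewrite linearB linearD /= !(prE _ (pr_mem _ _)).
by case: (nat_of_ord n) => [|[|i]] /=; rewrite ?addr0 ?add0r ?subrr ?h0 ?subr0.
Qed.

Hypothesis F_corad : forall n, (\sum_(m < n.+2) gr m)%VS =
   (comul @^-1: (tensv fullv (\sum_(m < n.+1) gr m) + tensv (\sum_(m < 1) gr m) fullv))%VS.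

(* The functional f detects the component of comul y of bidegree (1, m + 1); if
   this vanished, y would belong to the previous term of the coradical filtration. *)
Lemma degree1_component_neq0 m y : y \in gr m.+2 -> y != 0 ->
  exists f : 'Hom(H, k^o), pr 1%N (rslice (f \o pr m.+1)%VF y) != 0.
Proof.
move=> ym y0.
pose T := tmap (pr 1%N) (pr m.+1) (comul y).
have T0 : T != 0.
  apply: contraNneq y0 => T0.
  suffices : y \in (\sum_(j < m.+2) gr j)%VS.
    have sub : (\sum_(j < m.+2) gr j <= lker (pr m.+2))%VS.
      apply/subv_sumP => j _; apply/subvP => v vj.
      by rewrite memv_ker (prE _ vj) gtn_eqF.
    by move/(subvP sub); rewrite memv_ker (prE _ ym) eqxx.
  (* As [T = 0], [comul y] equals the Sweedler sum of [a (x) b - pr 1 a (x) pr m.+1 b]. For [a] of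
     degree 0 the term lies in [gr 0 (x) H], for degree 1 it cancels, and for degree at least 2 the
     factor [b] has degree at most [m]. *)
  rewrite F_corad -memv_preim -[comul y]tlift_tensK -[tlift _ _]subr0 -T0 /T /tmap.
  rewrite -tlift_sub_fun.
  have bF := bilin_sub (tens_bilin H H) (bilin_tens (pr 1%N) (pr m.+1)).
  apply: (tlift_comul_mem grP bF ym) => i j a b ij ai bj.
  rewrite /= (prE _ ai) (prE _ bj); case: i ij ai => [|[|i]] ij ai.
  - rewrite tens0l subr0 -[a \ox b]add0r memv_add ?mem0v // mem_tens ?memvf //.
    by rewrite big_ord1.
  - by move: ij; rewrite add1n => -[->]; rewrite !eqxx subrr mem0v.
  rewrite tens0l subr0 -[a \ox b]addr0 memv_add ?mem0v // mem_tens ?memvf //.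
  have jm : (j < m.+1)%N by rewrite ltnS; move: ij => [<-]; rewrite leq_addl.
  by apply: (subvP (sumv_sup (Ordinal jm) _ _)) bj.
have [/existsP[j sj0]|] := boolP [exists j,
    pr 1%N (rslice (coordf (vbasis fullv) j \o pr m.+1)%VF y) != 0].
  by exists (coordf (vbasis fullv) j).
rewrite negb_exists => /forallP s0; case/eqP: T0.
(* Expanding the second factor in a basis writes [T] as a sum of slices tensored with basis vectors,
   and each slice vanishes by [s0]. *)
pose F j u v := ((coordf (vbasis fullv) j (pr m.+1 v) : k) *: pr 1%N u)
  \ox ((vbasis fullv)`_j : H).
transitivity (tlift (fun u v => \sum_j F j u v) (comul y)).
  apply: eq_tlift => u v; rewrite [in LHS](coord_vbasis (memvf (pr m.+1 v))).
  rewrite -[LHS]/(tensr _ _ _) linear_sum; apply: eq_bigr => j _.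
  rewrite linearZ /F /= coordfE -[RHS]/(tensl _ _ _) linearZ //.
rewrite tlift_sum_fun big1 // => j _.
have := s0 j; rewrite negbK rsliceE linear_tlift => /eqP sj.
pose e : H := (vbasis fullv)`_j; rewrite -(tens0l H e) -sj.
rewrite -[RHS]/(tensl _ _ _) linear_tlift; apply: eq_tlift => u v /=.
by rewrite comp_lfunE linearZ.
Qed.

(** Let [n] be the top degree of [y]. If [n = 1], [y] itself works. If [n >= 2], slicing along a
    functional of degree [n - 1] stays in [D] and leaves degrees at most 1; [degree1_component_neq0]
    supplies one for which the degree 1 part, coming from the top component, is nonzero. *)
Lemma degree1_in_subcoalgebra (D : {vspace H}) y :
  subcoalgebra D -> y \in D -> y \notin gr 0 ->
  exists z, [/\ z \in D, pr 1%N z != 0 & forall i, (1 < i)%N -> pr i z = 0].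
Proof.
move=> sD yD y0; have [N sum] := pr_sum; have [N' full] := hopf_grading_full grP.
have yN i : pr i y != 0 -> (i <= N')%N.
  apply: contraR; rewrite -ltnNge => /ltnW Ni; rewrite -memv0.
  by rewrite -(hopf_grading_bounded grP full Ni).
have exn : exists n, pr n y != 0.
  have [/existsP[n yn]|] := boolP [exists n : 'I_N, pr n y != 0]; first by exists n.
  rewrite negb_exists => /forallP yn; case/negP: y0; rewrite (sum y) big1 ?mem0v // => i _.
  by apply/eqP; have := yn i; rewrite negbK.
case: (ex_maxnP exn yN) => -[|[|m]] yn maxn.
- case/negP: y0; rewrite (sum y) memv_suml // => -[[|i] /= _] _; first exact: pr_mem.
  have [-> |/maxn //] := eqVneq (pr i.+1 y) 0; exact: mem0v.
- exists y; split=> // i i1; apply/eqP; apply/negPn/negP => /maxn.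
  by rewrite leqNgt i1.
have [f fy] := degree1_component_neq0 (pr_mem _ y) yn.
exists (rslice (f \o pr m.+1)%VF y); split; first exact: rslice_mem.
  by rewrite pr_rslice add1n.
move=> i i1; rewrite pr_rslice; have -> : pr (i + m.+1)%N y = 0.
  apply/eqP; apply/negPn/negP => /maxn.
  by case: i i1 => [|[|i]] // _; rewrite addnS !addSn !ltnS ltnNge leq_addl.
by rewrite !linear0.
Qed.

End DegreeOne.

(** * The pair attached to a braided central Hopf subalgebra *)

Section FromForm.
Variables (k : fieldType) (gT : finGroupType).
Hypothesis pchar_k : [pchar k] =i pred0.
Variables (H : hopfAlgType k) (gr : nat -> {vspace H}).
Hypothesis gr_coradical : coradically_graded gr.
Hypothesis H_pointed : pointed H.
Variable iota : gT -> H.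
Hypothesis iotaP : grouplikes iota.
Variable p : 'End(H).
Hypothesis pP : graded_projection gr p.
Let grP : hopf_grading gr := proj1 gr_coradical.
Variables (theta : nat) (x : theta.-tuple H) (g : 'I_theta -> gT).
Hypothesis x_basis : basis_of (coinvariants1 gr p) x.
Hypothesis comul_x : forall i : 'I_theta,
     comul (tnth x i) = tnth x i \ox iota (g i) + 1 \ox tnth x i.

Let E := gcoord iota p.

Let E_iota a b : E a (iota b) = (a == b)%:R.
Proof. exact: (gcoord_iota gr_coradical iotaP pP). Qed.

Let E_gr a : degree0 gr (E a).
Proof. exact: (gcoord_gr iota pP). Qed.

Let comul_iota_x a i : comul (iota a * tnth x i) =
  (iota a * tnth x i) \ox iota (a * g i)%g + iota a \ox (iota a * tnth x i).
Proof.
rewrite (comul_grouplike_mul (comul_iota iotaP a) (comul_x i)) mulr1.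
by rewrite (grouplikesM iotaP).
Qed.

(** Each [iota d * x_i] is skew-primitive of weights [d] and [d g_i]. The two slices keep it if
    [a = d] and [b = d g_i] and kill it otherwise, and such elements span [H_1]. *)
Lemma comul_gr1_slice a b h : h \in gr 1 ->
  let v := lslice (E a) (rslice (E b) h) in
  comul v = v \ox iota b + iota a \ox v.
Proof.
move=> h1 v; rewrite {}/v.
have [c ->] := gr1_sum gr_coradical H_pointed iotaP pP x_basis h1.
pose F := (comul \o (lslice (E a) \o rslice (E b)))%VF.
pose G := ((linfun (tensl H (iota b)) + linfun (tensr H (iota a)))
             \o (lslice (E a) \o rslice (E b)))%VF.
have FE u : F u = comul (lslice (E a) (rslice (E b) u)).
  by rewrite /F [LHS]comp_lfunE comp_lfunE.
have GE u : G u = lslice (E a) (rslice (E b) u) \ox iota b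
    + iota a \ox lslice (E a) (rslice (E b) u).
  by rewrite /G [LHS]comp_lfunE comp_lfunE add_lfunE !lfunE.
rewrite -FE -GE !linear_sum; apply: eq_bigr => d _; rewrite !linear_sum.
apply: eq_bigr => i _; rewrite !linearZ; congr (_ *: _) => /=.
rewrite FE GE (rslice_skew _ (comul_iota_x d i)).
have ix1 : iota d * tnth x i \in gr 1.
  by rewrite -[1%N]add0n (gr_mul grP) ?(iota_gr0 gr_coradical iotaP) ?(x_gr1 x_basis).
rewrite !(E_gr _ _ ix1) // scale0r addr0 E_iota linearZ /=.
rewrite (lslice_skew _ (comul_iota_x d i)) (E_gr _ _ ix1) // scale0r add0r E_iota /=.
case: (eqVneq b) => [->|_]; last by rewrite scale0r linear0 tens0l tens0r addr0.
case: (eqVneq a) => [->|_]; last by rewrite scale0r scaler0 linear0 tens0l tens0r addr0.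
by rewrite !scale1r comul_iota_x.
Qed.

Variable K : {vspace H}.
Variable r : 'Hom(tensor H (subvs_of K), k^o).
Hypothesis bc : braided_central_axioms r.
Let K_coalg : subcoalgebra K.
Proof. by case: (bc_hopf bc). Qed.

(** Meaningful when [iota a] lies in [K], where [vsproj] does not change it; the lemmas about it
    assume this. *)
Definition group_functional (a : gT) : 'Hom(H, k^o) := lform r (vsproj K (iota a)).
Let f := group_functional.

Lemma group_functionalM a : iota a \in K -> {morph f a : u v / u * v}.
Proof.
move=> aK u v; rewrite [LHS]lformE (bc_mull bc) convl_grouplike 1?mulrC //.
by rewrite sub_comul_grouplike // comul_iota.
Qed.

Lemma group_functional1 a : iota a \in K -> f a 1 = 1.
Proof. by move=> aK; rewrite /f lformE (bc_onel bc) vsprojK // counit_iota. Qed.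

Lemma group_functional_iota_neq0 a b : iota a \in K -> f a (iota b) != 0.
Proof.
move=> aK; apply/eqP => fb; have /eqP := group_functional1 aK.
by rewrite -(iotaV iotaP b) group_functionalM // fb mul0r eq_sym oner_eq0.
Qed.

Lemma group_functional_gr a n h : iota a \in K -> (0 < n)%N -> h \in gr n -> f a h = 0.
Proof.
move=> aK n0 hn; have [N hN] := gr_nilpotent grP n0 hn.
have fX m : f a (h ^+ m) = (f a h : k) ^+ m.
  elim: m => [|m IHm]; first by rewrite !expr0 group_functional1.
  by rewrite !exprS group_functionalM // IHm.
apply/eqP; have /eqP := fX N; rewrite hN linear0 eq_sym expf_eq0.
by case/andP.
Qed.

Lemma group_functional_braid a h : iota a \in K ->
  iota a * lslice (f a) h = rslice (f a) h * iota a.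
Proof.
move=> aK; have bP := sub_comul_grouplike (comul_iota iotaP a) aK.
have := bc_braid bc h (vsproj K (iota a)).
by rewrite braid_left // braid_right // vsprojK.
Qed.

Lemma group_functional_sub a b : iota a \in K -> iota b \in K -> f a (iota b) = 1.
Proof.
move=> aK bK; rewrite /f lformE -{1}(vsprojK bK) (bc_sub bc) !vsprojK //.
by rewrite -(grouplikesM iotaP) counit_iota.
Qed.

Lemma group_functional_central a b : iota a \in K -> (a * b = b * a)%g.
Proof.
move=> aK; apply: (grouplikes_inj iotaP); rewrite !(grouplikesM iotaP).
have := group_functional_braid (iota b) aK.
rewrite lslice_grouplike ?rslice_grouplike ?comul_iota //.
rewrite -scalerAl -scalerAr => /(congr1 (fun u => (f a (iota b) : k)^-1 *: u)).
by rewrite !scalerK // group_functional_iota_neq0.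
Qed.

Lemma group_functional_x a i : iota a \in K ->
  iota a * tnth x i = (f a (iota (g i)) : k) *: (tnth x i * iota a).
Proof.
move=> aK; have := group_functional_braid (tnth x i) aK.
rewrite (lslice_skew _ (comul_x i)) (rslice_skew _ (comul_x i)).
rewrite group_functional1 // (group_functional_gr aK _ (x_gr1 x_basis i)) //.
by rewrite !scale0r scale1r add0r addr0 scalerAl.
Qed.

Lemma braided_central_sub_gr0 : (K <= gr 0)%VS.
Proof.
apply/subvP=> y yK; apply/negPn/negP => y0.
have [pr [pr_mem prE pr_sum]] := hopf_grading_projections grP.
have [_ [_ F_corad]] := gr_coradical.
have [z [zK z1 zi]] :=
  degree1_in_subcoalgebra grP prE pr_sum pr_mem F_corad K_coalg yK y0.
(* The slices w a b isolate the bicomodule component of weights (a, b), so that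
   the degree 1 part of w a b is skew-primitive. *)
pose w a b := lslice (E a) (rslice (E b) z).
pose w1 a b := pr 1%N (w a b).
have wK a b : w a b \in K by rewrite lslice_mem ?rslice_mem.
have w1E a b : w1 a b = lslice (E a) (rslice (E b) (pr 1%N z)).
  by rewrite /w1 (pr_lslice0 grP prE (E_gr a)) (pr_rslice0 grP prE (E_gr b)).
have wi a b i : (1 < i)%N -> pr i (w a b) = 0.
  move=> i1; rewrite (pr_lslice0 grP prE (E_gr a)) (pr_rslice0 grP prE (E_gr b)).
  by rewrite zi // !linear0.
(* The functionals [E a] sum to [counit], so the [w1 a b] sum to the nonzero element [pr 1 z]. *)
have [a [b w0]] : exists a b, w1 a b != 0.
  have [/existsP[a /existsP[b ab]]|] := boolP [exists a, exists b, w1 a b != 0].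
    by exists a, b.
  rewrite negb_exists => /forallP wab; case/eqP: z1.
  rewrite -[LHS]lslice_counit -(sum_gcoord gr_coradical H_pointed iotaP pP).
  rewrite lslice_sum big1 // => a _; rewrite -[pr _ _]rslice_counit.
  rewrite -(sum_gcoord gr_coradical H_pointed iotaP pP) rslice_sum.
  rewrite linear_sum big1 // => b _.
  rewrite -[LHS]/(lslice (E a) (rslice (E b) _)) -w1E; apply/eqP; have := wab a.
  by rewrite negb_exists => /forallP/(_ b); rewrite negbK.
set v := w1 a b in w0.
have v1 : v \in gr 1 := pr_mem _ _.
have comul_v : comul v = v \ox iota b + iota a \ox v.
  by rewrite /v w1E comul_gr1_slice.
have wE : w a b = pr 0%N (w a b) + v by apply: (low_split prE pr_sum pr_mem); apply: wi.
have [phi phiv] := exists_functional w0.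
have pr1_iota c : pr 1%N (iota c) = 0.
  by rewrite (prE _ _ _ (iota_gr0 gr_coradical iotaP c)).
(* [K] is stable under slices. In the right slice of [w a b] along [phi \o pr 1] the degree 0 part
   contributes nothing and [v] contributes [phi v] times [iota a]; the left slice gives [iota b] in
   the same way. *)
have aK : iota a \in K.
  have := rslice_mem (phi \o pr 1%N)%VF K_coalg (wK a b); rewrite wE linearD /=.
  rewrite (rslice_skew _ comul_v) !comp_lfunE pr1_iota linear0 scale0r add0r.
  rewrite (prE _ _ _ v1) /= rsliceE.
  have bF := bilin_scaler (phi \o pr 1%N)%VF (idfun : {linear H -> H}).
  have -> : tlift (fun u1 u2 => ((phi \o pr 1%N)%VF u2 : k) *: u1)
      (comul (pr 0%N (w a b))) = 0.
    apply/eqP; rewrite -memv0; apply: (tlift_comul_mem grP bF (pr_mem _ _)).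
    move=> [|i] [|j] u1 u2 // _ _ u2j; rewrite /= comp_lfunE (prE _ _ _ u2j) /=.
    by rewrite linear0 scale0r mem0v.
  by rewrite add0r => /(memvZ (phi v : k)^-1); rewrite scalerK.
have bK : iota b \in K.
  have := lslice_mem (phi \o pr 1%N)%VF K_coalg (wK a b); rewrite wE linearD /=.
  rewrite (lslice_skew _ comul_v) !comp_lfunE pr1_iota linear0 scale0r addr0.
  rewrite (prE _ _ _ v1) /= lsliceE.
  have bF := bilin_scalel (phi \o pr 1%N)%VF (idfun : {linear H -> H}).
  have -> : tlift (fun u1 u2 => ((phi \o pr 1%N)%VF u1 : k) *: u2)
      (comul (pr 0%N (w a b))) = 0.
    apply/eqP; rewrite -memv0; apply: (tlift_comul_mem grP bF (pr_mem _ _)).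
    move=> [|i] [|j] u1 u2 // _ u1i _; rewrite /= comp_lfunE (prE _ _ _ u1i) /=.
    by rewrite linear0 scale0r mem0v.
  by rewrite add0r => /(memvZ (phi v : k)^-1); rewrite scalerK.
(* The functional of [c] vanishes on [v] and is 1 on [iota a] and [iota b], both in [K], so both
   slices of [v] in the braid axiom are [v]. *)
have vc c : iota c \in K -> iota c * v = v * iota c.
  move=> cK; have := group_functional_braid v cK.
  rewrite (lslice_skew _ comul_v) (rslice_skew _ comul_v).
  rewrite (group_functional_gr cK _ v1) // !group_functional_sub //.
  by rewrite !scale0r !scale1r add0r addr0.
have cav : GRing.comm (iota a^-1%g) v.
  rewrite -(iota_inv iotaP); apply/commr_sym/commrV/commr_sym; exact: vc.
have cbv : GRing.comm (iota b) v by apply: vc.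
have cba : GRing.comm (iota b) (iota a^-1%g).
  rewrite /GRing.comm -!(grouplikesM iotaP); congr iota.
  exact: group_functional_central.
(* Translating [v] by the inverse of [a] gives a skew-primitive of weights 1 and [a^-1 b], commuting
   with [a^-1 b]. *)
have y00 : iota a^-1%g * v = 0.
  apply: (skew_primitive_eq0 grP (u := iota (a^-1 * b)%g) pchar_k).
  - by rewrite -[1%N]add0n (gr_mul grP) ?(iota_gr0 gr_coradical iotaP).
  - rewrite (comul_grouplike_mul (comul_iota iotaP _) comul_v).
    by rewrite -!(grouplikesM iotaP) mulVg (grouplikes1 iotaP).
  - exact: iota_unit.
  rewrite (grouplikesM iotaP) -/(GRing.comm _ _); apply/commr_sym.
  apply: commrM; apply/commr_sym; apply: commrM => //.
case/eqP: w0; rewrite -[v]mul1r -(iotaV iotaP a) -mulrA y00 mulr0 //.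
Qed.

Lemma iota_set_group_set : group_set [set a | iota a \in K].
Proof.
have [K1 KM _ _] := bc_hopf bc.
apply/group_setP; split=> [|a b]; rewrite !inE ?(grouplikes1 iotaP) // => aK bK.
by rewrite (grouplikesM iotaP) (subvP KM) ?memv_mul.
Qed.

Definition iota_group : {group gT} := group iota_set_group_set.

(** An element of [K] has degree 0, hence is a combination of group-likes. Its slice along [E a] is
    its term at [a] and stays in [K], so every group-like with nonzero coefficient lies in [K]. *)
Lemma braided_central_span : K = <<[seq iota a | a in iota_group]>>%VS.
Proof.
apply/eqP; rewrite eqEsubv; apply/andP; split; last first.
  by apply/span_subvP=> v /imageP[a aK ->]; rewrite inE in aK.
apply/subvP=> y yK; have y0 := subvP braided_central_sub_gr0 y yK.
have [p0 _] := pP; rewrite -(p0 y y0) (graded_projectionE gr_coradical H_pointed iotaP pP).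
rewrite memv_suml // => a _.
have [->|ya] := eqVneq (gcoord iota p a y) 0; first by rewrite scale0r mem0v.
apply: memvZ; apply: iota_span; rewrite inE.
have : lslice (E a) y \in K by apply: lslice_mem.
rewrite -[y in lslice _ y](p0 y y0) (graded_projectionE gr_coradical H_pointed iotaP pP).
rewrite linear_sum (bigD1 a) //= big1 => [|b ba];
  rewrite linearZ /= lslice_grouplike ?comul_iota // E_iota.
  by rewrite eqxx scale1r addr0 => /(memvZ (gcoord iota p a y : k)^-1); rewrite scalerK.
by rewrite eq_sym (negPf ba) scale0r scaler0.
Qed.

Let sgvalK (s : subg_of iota_group) : iota (sgval s) \in K.
Proof. by have := subgP s; rewrite inE. Qed.

Fact group_character_subproof (s : subg_of iota_group) :
  let chi := [ffun a => f (sgval s) (iota a) : k] in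
  (chi 1%g == 1) && [forall a, forall b, chi (a * b)%g == chi a * chi b].
Proof.
rewrite /= ffunE (grouplikes1 iotaP) group_functional1 // eqxx.
apply/forallP=> a; apply/forallP=> b.
by rewrite !ffunE (grouplikesM iotaP) group_functionalM.
Qed.

Definition group_character (s : subg_of iota_group) : gdual gT k :=
  GDual (group_character_subproof s).

Let gpair_character s a : gpair a (group_character s) = f (sgval s) (iota a).
Proof. by rewrite /gpair ffunE. Qed.

Lemma iota_group_central : iota_group \subset 'Z([set: gT])%g.
Proof.
apply/subsetP=> a; rewrite inE => aK; apply/centerP; split; rewrite ?inE // => b _.
exact: group_functional_central.
Qed.

(** Multiplicativity of [r] in its second argument makes the functional of a product a convolution,
    which at group-likes is the pointwise product. *)
Lemma group_character_morph :
  {morph [ffun s => group_character s] : s t / (s * t)%g}.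
Proof.
move=> s t; rewrite !ffunE; apply: gdualP => a; rewrite gpairMr !gpair_character.
have -> : f (sgval (s * t)%g) = conv (f (sgval s)) (f (sgval t)).
  apply/lfunP=> h; rewrite -convr_form -(bc_mulr bc) lformE.
  by rewrite /sub_mul !vsprojK // -(grouplikesM iotaP).
by rewrite conv_grouplike // comul_iota.
Qed.

Lemma group_character_isotropic (s t : subg_of iota_group) :
  gpair (sgval t) ([ffun s => group_character s] s) = 1.
Proof. by rewrite ffunE gpair_character group_functional_sub. Qed.

Lemma group_character_action (s : subg_of iota_group) (i : 'I_theta) :
  iota (sgval s) * tnth x i * (iota (sgval s))^-1
  = gpair (g i) ([ffun s => group_character s] s) *: tnth x i.
Proof.
rewrite ffunE gpair_character group_functional_x //.
by rewrite -scalerAl mulrK ?iota_unit.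
Qed.

Definition form_pair : central_pair iota x g :=
  CentralPair iota_group_central group_character_morph
    group_character_isotropic group_character_action.

Lemma form_pair_corresponds : corresponds gr form_pair (BraidedCentral bc).
Proof.
split=> /= [|c s|n h b n0 hn]; first exact: braided_central_span.
  by rewrite ffunE gpair_character -lformE.
move: b; apply: (subvs_span_ind braided_central_span) => [c u v ru rv||_ /imageP[a aK ->]].
- by rewrite tens_linearr linearP /= ru rv scaler0 addr0.
- by rewrite tens0r linear0.
rewrite -lformE; rewrite inE in aK; exact: group_functional_gr aK n0 hn.
Qed.

End FromForm.

(** * Uniqueness on both sides and the bijection *)

Section Correspondence.
Variables (k : fieldType) (gT : finGroupType).
Variables (H : hopfAlgType k) (gr : nat -> {vspace H}).
Hypothesis gr_coradical : coradically_graded gr.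
Hypothesis H_pointed : pointed H.
Variable iota : gT -> H.
Hypothesis iotaP : grouplikes iota.
Variable p : 'End(H).
Hypothesis pP : graded_projection gr p.
Variables (theta : nat) (x : theta.-tuple H) (g : 'I_theta -> gT).
Implicit Types (P : central_pair iota x g) (B : braided_central H).

(** The form is prescribed on group-likes and in positive degrees, which together span [H], against
    the group-likes that span [K]. *)
Lemma corresponds_form_uniq P B B' :
  corresponds gr P B -> corresponds gr P B' -> B = B'.
Proof.
case: B B' => K r bc [K' r' bc'] [/= KE rE r0] [/= K'E r'E r'0].
have KK' : K = K' by rewrite KE K'E.
(* The type of the form depends on [K], so the spaces are identified before the forms are
   compared. *)
case: K' / KK' in r' bc' K'E r'E r'0 *.
suffices rr' : r = r'.
  by case: r' / rr' in bc' r'E r'0 *; congr BraidedCentral; apply: proof_irrelevance.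
have rr' h b : r (h \ox b) = r' (h \ox b).
  move: b; apply: (subvs_span_ind KE) => [c u v ru rv||_ /imageP[a aG ->]].
  - by rewrite tens_linearr !linearP /= ru rv.
  - by rewrite tens0r !linear0.
  rewrite -!lformE; move: h.
  apply: (eq_linear_iota gr_coradical H_pointed iotaP pP) => [c|n h n0 hn] /=.
    by rewrite !lformE; apply: etrans (rE c (Subg aG)) (esym (r'E c (Subg aG))).
  by rewrite !lformE (r0 n) // (r'0 n).
apply/lfunP=> t; rewrite [t]tensE !linear_sum; apply: eq_bigr => i _.
by rewrite !linear_sum; apply: eq_bigr => j _; rewrite !linearZ /= rr'.
Qed.

(** Independence of group-likes in dual form: for [a] outside [G], [gcoord a] vanishes on the span
    but is 1 at [iota a]. *)
Lemma iota_in_span (G : {group gT}) a :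
  (iota a \in <<[seq iota c | c in G]>>%VS) = (a \in G).
Proof.
apply/idP/idP => [aG|]; last exact: iota_span.
apply: contraLR (oner_neq0 k) => naG; rewrite negbK.
have : (<<[seq iota c | c in G]>> <= lker (gcoord iota p a))%VS.
  apply/span_subvP=> _ /imageP[c cG ->].
  rewrite memv_ker (gcoord_iota gr_coradical iotaP pP).
  by case: (eqVneq a c) naG => [->|_ _]; rewrite ?cG ?eqxx.
move/subvP/(_ _ aG); rewrite memv_ker (gcoord_iota gr_coradical iotaP pP).
by rewrite eqxx.
Qed.

(** The group is recovered from [K] as the set of [a] with [iota a] in [K], and the characters as
    values of the form. *)
Lemma corresponds_pair_uniq P P' B :
  corresponds gr P B -> corresponds gr P' B -> P = P'.
Proof.
case: P P' => G Phi cG mG iG aG [G' Phi' cG' mG' iG' aG'] [/= KE rE _] [/= KE' rE' _].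
have GG' : G = G'.
  by apply/val_inj/setP => a /=; rewrite -!iota_in_span -KE KE'.
case: G' / GG' in Phi' cG' mG' iG' aG' KE' rE' *.
have PP' : Phi = Phi'.
  apply/ffunP => s; apply: gdualP => c; rewrite -rE -rE' //.
case: Phi' / PP' in mG' iG' aG' rE' *.
by congr CentralPair; apply: proof_irrelevance.
Qed.

End Correspondence.

Theorem proposition3p3
  (k : closedFieldType) (pchar_k : [pchar k] =i pred0)
  (gT : finGroupType)
  (H : hopfAlgType k) (gr : nat -> {vspace H})
  (gr_coradical : coradically_graded gr)
  (H_pointed : pointed H)
  (iota : gT -> H) (iotaP : grouplikes iota)
  (H_generated : agenv (<<[seq iota a | a : gT]>> + gr 1%N)%VS = fullv)
  (p : 'End(H)) (pP : graded_projection gr p)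
  (theta : nat) (x : theta.-tuple H) (g : 'I_theta -> gT)
  (x_basis : basis_of (coinvariants1 gr p) x)
  (comul_x : forall i : 'I_theta,
     comul (tnth x i) = tnth x i \ox iota (g i) + 1 \ox tnth x i) :
  exists2 f : central_pair iota x g -> braided_central H,
    bijective f & forall P, corresponds gr P (f P).
Proof.
(* Choice turns the correspondence, total in both directions, into maps [f] and [f']; the uniqueness
   lemmas make them mutually inverse. *)
have [f fP] := functional_choice _ (exists_corresponding_form
  gr_coradical H_pointed iotaP pP x_basis comul_x H_generated).
have ex_pair B : exists P : central_pair iota x g, corresponds gr P B.
  case: B => K r bc; exists (form_pair gr_coradical iotaP x_basis comul_x bc).
  exact: form_pair_corresponds.
have [f' f'P] := functional_choice _ ex_pair.
exists f => //; exists f' => [P|B].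
  exact: (corresponds_pair_uniq gr_coradical iotaP pP (f'P (f P)) (fP P)).
exact: (corresponds_form_uniq gr_coradical H_pointed iotaP pP (fP (f' B)) (f'P B)).
Qed.
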